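(* Let $V\subset\mathbb{R}^{n+1}$ be a compact convex set with non-empty interior, and suppose that the closed $n$-dimensional convex surface $\mathscr{M}=\partial V$ is also a smooth manifold. Then the Weyl polynomial $W_{\mathscr{M}}^{1}$ of $\mathscr{M}$ and the Steiner polynomial $S_V^{\mathbb{R}^{n+1}}$ of $V$ are related by $$2t\,W_{\mathscr{M}}^{1}(t)=S_V^{\mathbb{R}^{n+1}}(t)-S_V^{\mathbb{R}^{n+1}}(-t).$$
   Context: For a compact smooth hypersurface $\mathscr{M}\subset\mathbb{R}^{n+1}$ without boundary, the tube of radius $t>0$ is $\{x\in\mathbb{R}^{n+1}:\mathrm{dist}(x,\mathscr{M})\le t\}$ (Euclidean distance). By H. Weyl's theorem its $(n+1)$-dimensional volume is, for all sufficiently small $t>0$, equal to $2t\,W_{\mathscr{M}}^{1}(t)$ with $W_{\mathscr{M}}^{1}$ an even polynomial; this defines the Weyl polynomial $W_{\mathscr{M}}^{1}$ of index $1$ (here it is defined through the tube volume). The Steiner polynomial $S_V^{\mathbb{R}^{n+1}}$ is the polynomial satisfying $S_V^{\mathbb{R}^{n+1}}(t)=\mathrm{Vol}_{n+1}(V+tB^{n+1})$ for all real $t\ge0$, where $B^{n+1}$ is the closed unit ball. *)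

(* Defs.v *)
From HB Require Import structures.
From mathcomp Require Import all_boot all_order all_algebra.
From mathcomp Require Import all_classical all_reals all_analysis.
Set Implicit Arguments.
Unset Strict Implicit.
Unset Printing Implicit Defensive.
Import Order.TTheory GRing.Theory Num.Theory numFieldNormedType.Exports.
Local Open Scope classical_set_scope.
Local Open Scope ring_scope.

(* The norm `|x| of the library on 'rV[R]_d is the sup norm: it induces the
   usual topology, but lengths and distances are measured with enorm. *)
Definition enorm (R : realType) (d : nat) (x : 'rV[R]_d) : R :=
  Num.sqrt (\sum_(i < d) x ord0 i ^+ 2).

Definition edistance (R : realType) (d : nat) (x : 'rV[R]_d)
    (A : set 'rV[R]_d) : R :=
  inf [set enorm (x - y) | y in A].

Definition tube (R : realType) (d : nat) (M : set 'rV[R]_d) (t : R) :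
    set 'rV[R]_d :=
  [set x | edistance x M <= t].

Definition unit_ball (R : realType) (d : nat) : set 'rV[R]_d :=
  [set x | enorm x <= 1].

Definition minkowski_sum (R : realType) (d : nat) (A B : set 'rV[R]_d) :
    set 'rV[R]_d :=
  [set x + y | x in A & y in B].

Definition dilate (R : realType) (d : nat) (t : R) (A : set 'rV[R]_d) :
    set 'rV[R]_d :=
  [set t *: x | x in A].

(* d-dimensional Lebesgue measure: the d-fold product of lebesgue_measure,
   carried over to d-tuples by (x, (x_1, .., x_d)) |-> (x, x_1, .., x_d). *)
Fixpoint lebesgue_tuple (R : realType) (d : nat) :
    set (d.-tuple R) -> \bar R :=
  match d with
  | 0 => dirac [tuple]
  | d'.+1 =>
      pushforward
        (product_measure1 (@lebesgue_measure R) (@lebesgue_tuple R d'))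
        (fun p : R * d'.-tuple R => [tuple of p.1 :: p.2])
  end.

Definition volume (R : realType) (d : nat) (A : set 'rV[R]_d) : \bar R :=
  lebesgue_tuple [set u : d.-tuple R | A (\row_i tnth u i)].

Definition boundary (T : topologicalType) (A : set T) : set T :=
  closure A `\` interior A.

Fixpoint class_C (R : realType) (d k : nat) (U : set 'rV[R]_d.+1)
    (f : 'rV[R]_d.+1 -> R) : Prop :=
  (forall x, U x -> {for x, continuous f}) /\
  match k with
  | 0 => True
  | k'.+1 => forall i : 'I_d.+1,
      (forall x, U x -> derivable f x (delta_mx ord0 i)) /\
      class_C k' U (fun x => 'D_(delta_mx ord0 i) f x)
  end.

(* Only meaningful for open U. *)
Definition smooth_on (R : realType) (d : nat) (U : set 'rV[R]_d.+1)
    (h : 'rV[R]_d.+1 -> 'rV[R]_d.+1) : Prop :=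
  forall (k : nat) (i : 'I_d.+1), class_C k U (fun x => h x ord0 i).

Definition diffeomorphism (R : realType) (d : nat) (U W : set 'rV[R]_d.+1)
    (h : 'rV[R]_d.+1 -> 'rV[R]_d.+1) : Prop :=
  [/\ open U, open W, h @` U = W, smooth_on U h &
      exists2 g : 'rV[R]_d.+1 -> 'rV[R]_d.+1,
        (forall x, U x -> g (h x) = x) & smooth_on W g].

(* n-dimensional smooth (embedded) submanifold of R^(n+1): around each of its
   points, some diffeomorphism between open sets of R^(n+1) straightens M to
   the hyperplane R^n x {0}. *)
Definition smooth_hypersurface (R : realType) (n : nat)
    (M : set 'rV[R]_n.+1) : Prop :=
  forall p, M p ->
    exists U W : set 'rV[R]_n.+1, exists h : 'rV[R]_n.+1 -> 'rV[R]_n.+1,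
      [/\ U p, diffeomorphism U W h &
          h @` (U `&` M) = W `&` [set y | y ord0 ord_max = 0]].

(* At most one polynomial satisfies each of the next two predicates, since it
   is prescribed on an infinite set of values of t. *)
Definition is_weyl_polynomial (R : realType) (n : nat) (M : set 'rV[R]_n.+1)
    (w : {poly R}) : Prop :=
  (forall t : R, w.[- t] = w.[t]) /\
  \forall t \near (0 : R)^'+, volume (tube M t) = (2 * t * w.[t])%:E.

Definition is_steiner_polynomial (R : realType) (n : nat)
    (V : set 'rV[R]_n.+1) (s : {poly R}) : Prop :=
  forall t : R, 0 <= t ->
    volume (minkowski_sum V (dilate t (@unit_ball R n.+1))) = (s.[t])%:E.

(* Main.v *)
(** For small [t > 0] the tube is [V + tB] minus the inner part
    [I_t = {x in V | dist(x, bd V) > t}], so everything reduces to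
    [Vol(I_t) = S(-t)].  Since [bd V] is C^2, a ball of some fixed radius [r] rolls
    inside [V]: with [K = {x | x + rB included in V}] one has [V + uB = K + (r + u)B]
    for [u >= 0], and [K + (r - t)B] is [I_t] up to taking [>=] for [>].  Hence
    [v(x) = Vol(K + xB)] equals [S(x - r)] for [x >= r] and the polynomial
    [S(t) - 2tW(t)] at [x = r - t] for small [t > 0]; it remains to see that a single
    polynomial gives both.  This is Steiner's formula for [K], proved by approximating
    [B] by zonotopes: the volume of [K + s[0,e]] is affine in [s] by translation
    invariance alone, so the volume of [K + sZ] is a polynomial in [s] for a zonotope [Z],
    and its degree is bounded by that of [S] because it grows no faster.  Polynomials of
    bounded degree converging on [x >= r] converge everywhere, to the same polynomial. *)

Require Import Defs.
From HB Require Import structures.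
From mathcomp Require Import all_boot all_order all_algebra.
From mathcomp Require Import all_classical all_reals all_analysis.
From mathcomp Require Import measurable_realfun qpoly ring lra.
From mathcomp Require finmap polyrcf.
Set Implicit Arguments.
Unset Strict Implicit.
Unset Printing Implicit Defensive.
Import Order.TTheory GRing.Theory Num.Theory numFieldNormedType.Exports.
Local Open Scope classical_set_scope.
Local Open Scope ring_scope.

(** * Lebesgue measure on tuples *)

(** The hypothesis on [s] concerns [t >= 0] only, so nothing ties [s.[- t]] to a volume beforehand:
    the link is the single function [v], and that it is close to polynomials across [x = r] is the
    crux. Zonotopes serve because their case needs no mixed volumes: sweeping a convex body along a
    segment is a one-dimensional matter. That the ball is a limit of zonotopes is usually seen by
    averaging segments over the sphere; an extremal argument with finitely many reflections replaces
    that integral here. The approximation is relative, [B] inside [Z] inside [(1 + e)B], so that the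
    error is a change of the argument of [v], from [u] to [(1 + e)u]. At the points that matter [v]
    is already known to be [S] or the polynomial [S(t) - 2tW(t)], whose continuity makes the error
    vanish; no continuity of [v] has to be proved. The same device settles strict against weak
    inequality in [I_t]: the level sets of the distance to the boundary are never measured. *)

Definition translate (R : realType) (c : R) (x : measurableTypeR R) : measurableTypeR R :=
  x + c.

(** The measure pushed forward by the translation agrees with Lebesgue measure on half-open
    intervals, and these determine it. *)
Lemma lebesgue_measure_shift (R : realType) (c : R) (A : set (measurableTypeR R)) :
  measurable A -> lebesgue_measure (translate c @^-1` A) = lebesgue_measure A.
Proof.
have mf : measurable_fun setT (translate c).
  exact: measurable_funD.
move=> mA; apply/esym.
apply: (@lebesgue_measure_unique R
  (pushforward (@lebesgue_measure R) (translate c))) => // X [[a b] _ <-] /=.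
have -> : pushforward (@lebesgue_measure R) (translate c) `]a, b]%classic =
    lebesgue_measure `]a - c, b - c]%classic.
  rewrite /pushforward; congr (lebesgue_measure _); apply/seteqP; split=> x /=;
  rewrite /translate !in_itv/= => /andP[? ?]; apply/andP; split; lra.
rewrite !lebesgue_measure_itv /= !lte_fin ltrD2r.
by case: ifP => // _; rewrite -!EFinD; congr EFin; lra.
Qed.

Definition shift_tuple (R : realType) d (c t : d.-tuple R) : d.-tuple R :=
  [tuple tnth t i + tnth c i | i < d].

Lemma measurable_shift_tuple (R : realType) d (c : d.-tuple R) :
  measurable_fun setT (shift_tuple c).
Proof.
apply/measurable_fun_tnthP => i.
rewrite (_ : _ \o _ = fun t => tnth t i + tnth c i); last first.
  by apply/funext => t /=; rewrite tnth_mktuple.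
by apply: measurable_funD => //; exact: measurable_tnth.
Qed.

Definition tuple_box (R : realType) d (M : R) : set (d.-tuple R) :=
  [set u | forall i, tnth u i \in `[- M, M]].

Lemma measurable_tuple_box (R : realType) d (M : R) :
  measurable (@tuple_box R d M).
Proof.
have -> : @tuple_box R d M =
  \bigcap_(i in [set: 'I_d]) (@tnth _ R ^~ i @^-1` `[- M, M]%classic).
  by apply/seteqP; split => [u Mu i _|u Mu i] /=; exact: Mu.
apply: fin_bigcap_measurable => // i _.
by rewrite -[X in measurable X]setTI; exact: measurable_tnth.
Qed.

Section cons_measure.
Context (R : realType) (d : nat).
Variable mu : {sigma_finite_measure set (d.-tuple R) -> \bar R}.

Definition tuple_cons (p : measurableTypeR R * d.-tuple R) : d.+1.-tuple R :=
  [tuple of p.1 :: p.2].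

Lemma measurable_tuple_cons : measurable_fun setT tuple_cons.
Proof. exact: measurable_cons. Qed.

(** One step of the recursion behind [lebesgue_tuple], started from a [mu] that carries a measure
    structure: [lebesgue_tuple] itself is a bare function, to which no theorem on measures applies
    directly. *)
Definition cons_measure : set (d.+1.-tuple R) -> \bar R :=
  pushforward (@lebesgue_measure R \x mu)%E tuple_cons.

Let cons_measure0 : cons_measure set0 = 0%E.
Proof. by rewrite /cons_measure /pushforward preimage_set0 measure0. Qed.

Let cons_measure_ge0 A : (0 <= cons_measure A)%E.
Proof. by rewrite /cons_measure /pushforward; apply: measure_ge0. Qed.

Let cons_measure_sigma_additive : semi_sigma_additive cons_measure.
Proof. exact: (@measure_semi_sigma_additive _ _ _
  (measure_function_pushforward__canonical__measure_function_Measure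
     (@lebesgue_measure R \x mu)%E measurable_tuple_cons)).
Qed.

HB.instance Definition _ := isMeasure.Build _ _ _ cons_measure
  cons_measure0 cons_measure_ge0 cons_measure_sigma_additive.

Let cons_measure_sigma_finite : sigma_finite setT cons_measure.
Proof.
have /sigma_finiteP[F [TF ndF Foo]] := sigma_finiteT (@lebesgue_measure R).
have /sigma_finiteP[G [TG ndG Goo]] := sigma_finiteT mu.
pose hd := fun t : d.+1.-tuple R => (thead t : measurableTypeR R).
pose tl := fun t : d.+1.-tuple R => [tuple of behead t].
have mhd : measurable_fun setT hd by exact: measurable_tnth.
have mtl : measurable_fun setT tl by exact: measurable_behead.
exists (fun n => hd @^-1` F n `&` tl @^-1` G n).
  apply/esym/seteqP; split => // t _.
  have [n _ Fn] : (\bigcup_n F n) (hd t) by rewrite -TF.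
  have [k _ Gk] : (\bigcup_n G n) (tl t) by rewrite -TG.
  (* Both exhausting sequences are nondecreasing, so one index serves head and tail. *)
  exists (maxn n k) => //; split => /=.
    by move: Fn; exact/subsetPset/ndF/leq_maxl.
  by move: Gk; exact/subsetPset/ndG/leq_maxr.
move=> k; have [mF Fk] := Foo k; have [mG Gk] := Goo k; split.
  apply: measurableI.
    by rewrite -[X in measurable X]setTI; exact: mhd.
  by rewrite -[X in measurable X]setTI; exact: mtl.
rewrite /cons_measure /pushforward.
have -> : tuple_cons @^-1` (hd @^-1` F k `&` tl @^-1` G k) = F k `*` G k.
  apply/seteqP; split => -[x t] /=; rewrite /hd /tl /tuple_cons theadE /=.
    by move=> [Fx Gt]; split => //=; congr (G k _): Gt; apply/val_inj.
  by move=> [Fx Gt]; split => //=; congr (G k _): Gt; apply/val_inj.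
by rewrite product_measure1E// lte_mul_pinfty// ge0_fin_numE.
Qed.

HB.instance Definition _ := Measure_isSigmaFinite.Build _ _ _ cons_measure
  cons_measure_sigma_finite.

(** Through [tuple_cons] a shift acts separately on head and tail; both measures then agree on
    rectangles, and a product measure is determined by these. *)
Lemma cons_measure_shift c A :
  (forall c' B, measurable B -> mu (shift_tuple c' @^-1` B) = mu B) ->
  measurable A -> cons_measure (shift_tuple c @^-1` A) = cons_measure A.
Proof.
move=> mu_shift mA.
pose c0 : R := thead c; pose c1 : d.-tuple R := [tuple of behead c].
pose f (p : measurableTypeR R * d.-tuple R) : measurableTypeR R * d.-tuple R :=
  (p.1 + c0, shift_tuple c1 p.2).
have mf : measurable_fun setT f.
  apply/measurable_fun_pairP; split => /=.
    by apply: measurable_funD.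
  exact: (measurableT_comp (measurable_shift_tuple c1) measurable_snd).
have fE : tuple_cons @^-1` (shift_tuple c @^-1` A) = f @^-1` (tuple_cons @^-1` A).
  rewrite /preimage /=; apply/funext => -[x t] /=; congr (A _).
  apply/eq_from_tnth => i; rewrite tnth_mktuple.
  case: (unliftP ord0 i) => [j|] ->.
    by rewrite !tnthS tnth_mktuple (tuple_eta c) tnthS.
  by rewrite !tnth0 {1}(tuple_eta c) tnth0.
rewrite /cons_measure /pushforward fE.
apply/esym; apply: (@product_measure_unique _ _ _ _ _ (@lebesgue_measure R) mu
 (measure_function_pushforward__canonical__measure_function_Measure
     (@lebesgue_measure R \x mu)%E mf)); last first.
  by rewrite -[X in measurable X]setTI; exact: measurable_tuple_cons.
move=> X Y mX mY.
change ((@lebesgue_measure R \x mu)%E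
  (translate c0 @^-1` X `*` shift_tuple c1 @^-1` Y) = (lebesgue_measure X * mu Y)%E).
rewrite product_measure1E//.
- by congr (_ * _)%E; [exact: lebesgue_measure_shift|exact: mu_shift].
- by rewrite -[X in measurable X]setTI; apply: measurable_funD.
- by rewrite -[X in measurable X]setTI; apply: measurable_shift_tuple.
Qed.

Lemma cons_measure_box (M : R) :
  (mu (tuple_box M) < +oo)%E ->
  (cons_measure (tuple_box M) < +oo)%E.
Proof.
move=> muM; rewrite /cons_measure /pushforward.
have -> : tuple_cons @^-1` (tuple_box M) =
    `[- M, M]%classic `*` tuple_box M.
  rewrite /tuple_box; apply/seteqP; split => -[x t] /= h.
    by split => [|i]; [have := h ord0; rewrite tnth0|have := h (lift ord0 i); rewrite tnthS].
  move=> i; case: (unliftP ord0 i) => [j|] ->; first by rewrite tnthS; exact: h.2.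
  by rewrite tnth0; exact: h.1.
rewrite product_measure1E//; last exact: measurable_tuple_box.
rewrite lte_mul_pinfty//.
have : (@lebesgue_measure R `[(- M)%R, M]%classic < +oo)%E.
  by rewrite lebesgue_measure_itv/=; case: ifP => // _; rewrite -EFinB ltry.
by rewrite ge0_fin_numE.
Qed.

End cons_measure.

(** All later facts on [volume] come through this [mu]. Finiteness on boxes is what makes compact
    sets have finite volume. *)
Lemma lebesgue_tuple_measure (R : realType) d :
  exists mu : {sigma_finite_measure set (d.-tuple R) -> \bar R},
    [/\ @lebesgue_tuple R d = mu,
     forall c A, measurable A -> mu (shift_tuple c @^-1` A) = mu A &
     forall M : R, (mu (tuple_box M) < +oo)%E].
Proof.
elim: d => [|d [mu [muE mu_shift mu_box]]].
  exists (\d_([tuple] : 0.-tuple R)); split => // [c A mA|M].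
    congr (dirac _ _); apply/seteqP; split => x /=;
    by rewrite (tuple0 x) (tuple0 (shift_tuple _ _)).
  by rewrite /dirac ltry.
exists (cons_measure mu); split; first by rewrite /= muE.
  by move=> c A; exact: cons_measure_shift.
by move=> M; exact: cons_measure_box.
Qed.

(** * Euclidean geometry of row vectors *)

Section euclid.
Context (R : realType) (d : nat).
Implicit Types (x y z : 'rV[R]_d) (a t : R).

Definition dot x y : R := (x *m y^T) ord0 ord0.

Lemma dotE x y : dot x y = \sum_i x ord0 i * y ord0 i.
Proof. by rewrite /dot mxE; apply: eq_bigr => i _; rewrite mxE. Qed.

Lemma dotC x y : dot x y = dot y x.
Proof. by rewrite !dotE; apply: eq_bigr => i _; rewrite mulrC. Qed.

Lemma dotDl x y z : dot (x + y) z = dot x z + dot y z.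
Proof. by rewrite /dot mulmxDl mxE. Qed.

Lemma dotZl a x y : dot (a *: x) y = a * dot x y.
Proof. by rewrite /dot -scalemxAl mxE. Qed.

Lemma dotNl x y : dot (- x) y = - dot x y.
Proof. by rewrite -scaleN1r dotZl mulN1r. Qed.

Lemma dotBl x y z : dot (x - y) z = dot x z - dot y z.
Proof. by rewrite dotDl dotNl. Qed.

Lemma dot0l x : dot 0 x = 0.
Proof. by rewrite -(scale0r x) dotZl mul0r. Qed.

Lemma dotDr x y z : dot z (x + y) = dot z x + dot z y.
Proof. by rewrite dotC dotDl !(dotC z). Qed.

Lemma dotZr a x y : dot x (a *: y) = a * dot x y.
Proof. by rewrite dotC dotZl dotC. Qed.

Lemma dotNr x y : dot x (- y) = - dot x y.
Proof. by rewrite dotC dotNl dotC. Qed.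

Lemma dotBr x y z : dot z (x - y) = dot z x - dot z y.
Proof. by rewrite dotDr dotNr. Qed.

Lemma dot0r x : dot x 0 = 0.
Proof. by rewrite dotC dot0l. Qed.

Lemma enormE x : enorm x = Num.sqrt (dot x x).
Proof. by rewrite /enorm dotE; congr Num.sqrt; apply: eq_bigr => i _; rewrite expr2. Qed.

Lemma dot_ge0 x : 0 <= dot x x.
Proof. by rewrite dotE; apply: sumr_ge0 => i _; rewrite -expr2 sqr_ge0. Qed.

Lemma sqr_enorm x : enorm x ^+ 2 = dot x x.
Proof. by rewrite enormE sqr_sqrtr// dot_ge0. Qed.

Lemma enorm_ge0 x : 0 <= enorm x.
Proof. by rewrite enormE sqrtr_ge0. Qed.

Lemma normr_le_enorm_coord x i : `|x ord0 i| <= enorm x.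
Proof.
rewrite -(@ler_pXn2r _ 2)// ?nnegrE ?enorm_ge0// sqr_enorm dotE -normrX ger0_norm ?sqr_ge0//.
by rewrite (bigD1 i)//= expr2 lerDl; apply: sumr_ge0 => j _; rewrite -expr2 sqr_ge0.
Qed.

Lemma enorm_eq0 x : enorm x = 0 -> x = 0.
Proof.
move=> x0; apply/rowP => i; rewrite mxE; apply/eqP; rewrite -normr_le0 -x0.
exact: normr_le_enorm_coord.
Qed.

Lemma enorm_gt0 x : x != 0 -> 0 < enorm x.
Proof.
move=> x0; rewrite lt_neqAle enorm_ge0 andbT eq_sym; apply: contra_neq x0.
exact: enorm_eq0.
Qed.

Lemma enormZ a x : enorm (a *: x) = `|a| * enorm x.
Proof.
rewrite !enormE dotZl dotZr mulrA -expr2 sqrtrM ?sqr_ge0//.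
by rewrite sqrtr_sqr.
Qed.

Lemma enorm0 : enorm (0 : 'rV[R]_d) = 0.
Proof. by rewrite -(scale0r 0) enormZ normr0 mul0r. Qed.

Lemma enormN x : enorm (- x) = enorm x.
Proof. by rewrite -scaleN1r enormZ normrN1 mul1r. Qed.

Lemma enormB x y : enorm (x - y) = enorm (y - x).
Proof. by rewrite -enormN opprB. Qed.

Lemma dot_le x y : dot x y <= enorm x * enorm y.
Proof.
have [->|y0] := eqVneq y 0; first by rewrite dot0r enorm0 mulr0.
have y_gt0 := enorm_gt0 y0.
have [xy0|xy0] := leP (dot x y) 0.
  by apply: le_trans xy0 _; rewrite mulr_ge0 ?enorm_ge0.
rewrite -(@ler_pXn2r _ 2)// ?nnegrE ?mulr_ge0 ?enorm_ge0 ?(ltW xy0)//.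
(* This square equals [|y|^2 * (|x|^2 * |y|^2 - (dot x y)^2)]. *)
have := dot_ge0 ((enorm y ^+ 2) *: x - dot x y *: y).
rewrite exprMn !(dotBl, dotBr, dotZl, dotZr) (dotC y x) -!sqr_enorm => h.
rewrite -subr_ge0 -(pmulr_rge0 _ (exprn_gt0 2 y_gt0)).
by apply: le_trans h _; rewrite le_eqVlt; apply/orP; left; apply/eqP; ring.
Qed.

Lemma enormD x y : enorm (x + y) <= enorm x + enorm y.
Proof.
rewrite -(@ler_pXn2r _ 2)// ?nnegrE ?addr_ge0 ?enorm_ge0//.
rewrite sqr_enorm !(dotDl, dotDr) (dotC y x) sqrrD -!sqr_enorm.
have := dot_le x y; rewrite mulr2n; lra.
Qed.

Lemma ler_enormB x y z : enorm (x - z) <= enorm (x - y) + enorm (y - z).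
Proof. by have := enormD (x - y) (y - z); rewrite addrA subrK. Qed.

Lemma ler_norm_enorm x : `|x| <= enorm x.
Proof.
have [[i ->]|x0] := pselect (exists i, `|x| = `|x ord0 i|).
  exact: normr_le_enorm_coord.
rewrite leNgt; apply/negP => xlt.
have /mx_norm_neq0[[i j]/= xij] : mx_norm x != 0.
  by rewrite gt_eqF// (le_lt_trans _ xlt)// enorm_ge0.
by apply: x0; exists j; rewrite [LHS]xij (ord1 i).
Qed.

Lemma normr_coord_le x i : `|x ord0 i| <= `|x|.
Proof.
rewrite [leRHS]/Num.norm /= mx_normrE.
apply: (@le_bigmax _ _ _ 0 (fun ij : 'I_1 * 'I_d => `|x ij.1 ij.2|) (ord0, i)).
Qed.

Lemma enorm_le_norm x : enorm x <= d%:R * `|x|.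
Proof.
rewrite -(@ler_pXn2r _ 2)// ?nnegrE ?mulr_ge0 ?enorm_ge0//.
rewrite sqr_enorm dotE exprMn.
have -> : (d%:R : R) ^+ 2 * `|x| ^+ 2 = \sum_(i < d) d%:R * `|x| ^+ 2.
  by rewrite sumr_const card_ord -[RHS]mulr_natl mulrA -expr2.
apply: ler_sum => i _; rewrite -expr2 -[_ ^+ 2]ger0_norm ?sqr_ge0// normrX.
rewrite -[leLHS]mul1r ler_pM ?exprn_ge0// ?ler1n ?(leq_ltn_trans _ (ltn_ord i))//.
by rewrite ler_pXn2r ?nnegrE// normr_coord_le.
Qed.

Lemma nbhs_enormP x (A : set 'rV[R]_d) :
  nbhs x A <-> exists2 e, 0 < e & forall y, enorm (x - y) < e -> A y.
Proof.
split.
  move=> /nbhs_ballP[e e0 eA]; exists e => // y xy; apply: eA.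
  by rewrite mx_norm_ball; exact: le_lt_trans (ler_norm_enorm _) xy.
(* The divisor is [d%:R + 1] because [d%:R] vanishes in dimension [0]. *)
move=> [e e0 eA]; have d1 : (0 : R) < d%:R + 1 by rewrite ltr_wpDl.
apply/nbhs_ballP; exists (e / (d%:R + 1)) => /=; first by rewrite divr_gt0.
move=> y; rewrite mx_norm_ball /ball_/= => xy; apply: eA.
apply: le_lt_trans (enorm_le_norm _) _.
apply: (@le_lt_trans _ _ ((d%:R + 1) * `|x - y|)).
  by rewrite ler_wpM2r// lerDl.
by rewrite mulrC -ltr_pdivlMr.
Qed.

Lemma normr_enormB_le x y : `|enorm x - enorm y| <= enorm (x - y).
Proof.
have h (u v : 'rV[R]_d) : enorm u - enorm v <= enorm (u - v).
  by rewrite lerBlDr; have := enormD (u - v) v; rewrite subrK.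
by rewrite ler_norml h andbT lerNl opprB enormB h.
Qed.

Lemma enorm_continuous : continuous (@enorm R d).
Proof.
move=> x; apply/(@cvgrPdist_lt _ _ _ _ (nbhs_filter x)) => /= e e0.
by apply/nbhs_enormP; exists e => // y; exact/le_lt_trans/normr_enormB_le.
Qed.

Lemma enormB_continuous y : continuous (fun x => enorm (y - x)).
Proof.
move=> x; apply/(@cvgrPdist_lt _ _ _ _ (nbhs_filter x)) => /= e e0.
apply/nbhs_enormP; exists e => // z xz; apply: le_lt_trans xz.
apply: le_trans (normr_enormB_le _ _) _.
by rewrite (enormB x) opprB addrC addrA subrK.
Qed.

Definition cball t : set 'rV[R]_d := [set x | enorm x <= t].

Lemma closed_cball t : closed (cball t).
Proof.
rewrite (_ : cball t = @enorm R d @^-1` [set u | u <= t])//.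
apply: closed_comp; last exact: closed_le.
by move=> x _; exact: enorm_continuous.
Qed.

Lemma compact_cball t : compact (cball t).
Proof.
apply: bounded_closed_compact; last exact: closed_cball.
exists t; split; first exact: num_real.
move=> u tu x /= xt; apply: le_trans (ler_norm_enorm _) _.
exact: le_trans xt (ltW tu).
Qed.

Lemma open_enormP (A : set 'rV[R]_d) :
  open A <-> forall x, A x -> exists2 e, 0 < e & forall y, enorm (x - y) < e -> A y.
Proof.
rewrite openE; split => h x Ax; first by apply/nbhs_enormP; exact: h.
by rewrite /interior /=; apply/nbhs_enormP; exact: h.
Qed.

Lemma compact_minkowski_sum A B : compact A -> compact B -> compact (@minkowski_sum R d A B).
Proof.
move=> cA cB.
have -> : minkowski_sum A B = (fun p : 'rV[R]_d * 'rV[R]_d => p.1 + p.2) @` (A `*` B).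
  apply/seteqP; split=> [_ [x Ax [y By <-]]|_ [[x y] [/= Ax By] <-]].
    by exists (x, y).
  by exists x => //; exists y.
apply: continuous_compact; last exact: compact_setX.
by apply: continuous_subspaceT => p; exact: add_continuous.
Qed.

(** The library's [convex_set] takes its coefficient in a type of numbers of the unit interval; a
    real with two bounds suits [lra]. *)
Definition is_convex (A : set 'rV[R]_d) := forall x y l, A x -> A y -> 0 <= l -> l <= 1 ->
  A (l *: x + (1 - l) *: y).

Lemma convex_set_is_convex (A : set 'rV[R]_d) : convex_set A -> is_convex A.
Proof.
move=> cA x y l Ax Ay l0 l1.
have l01 : Itv.spec (@Itv.num_sem R) (Itv.Real `[0, 1]) l.
  by rewrite /Itv.num_sem/= in_itv/= l0 l1 num_real.
have := cA x y (Itv.mk l01).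
by rewrite !inE => /(_ Ax Ay).
Qed.

Lemma convex_minkowski_sum A B : is_convex A -> is_convex B -> is_convex (minkowski_sum A B).
Proof.
move=> cA cB _ _ l [a Aa [b Bb <-]] [a' Aa' [b' Bb' <-]] l0 l1.
exists (l *: a + (1 - l) *: a'); first exact: cA.
exists (l *: b + (1 - l) *: b'); first exact: cB.
by rewrite !scalerDr addrACA.
Qed.

Lemma dilate_unit_ball t : 0 <= t -> dilate t (@unit_ball R d) = cball t.
Proof.
rewrite le_eqVlt => /orP[/eqP <-|t0].
  apply/seteqP; split=> [_ [x _ <-]|x]; rewrite /cball/=.
    by rewrite scale0r enorm0.
  move=> x0; have -> : x = 0 by apply/enorm_eq0/le_anti; rewrite x0 enorm_ge0.
  by exists 0; rewrite ?scaler0// /unit_ball/= enorm0.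
apply/seteqP; split=> [_ [x x1 <-]|x xt]; rewrite /cball/=.
  by rewrite enormZ gtr0_norm// -[leRHS]mulr1 ler_pM2l.
exists (t^-1 *: x); last by rewrite scalerA divff ?scale1r// gt_eqF.
by rewrite /unit_ball/= enormZ gtr0_norm ?invr_gt0// ler_pdivrMl// mulr1.
Qed.

End euclid.

(** * Volume of compact sets *)

Section volume.
Context (R : realType) (d : nat).
Implicit Types A B : set 'rV[R]_d.

Definition coords A : set (d.-tuple R) := [set u | A (\row_i tnth u i)].

Definition measurable_rV A : Prop := measurable (coords A).

Lemma measurable_rV_box (a b : 'I_d -> R) :
  measurable_rV [set x | forall i, x ord0 i \in `]a i, b i[].
Proof.
rewrite /measurable_rV.
have -> : coords [set x | forall i, x ord0 i \in `]a i, b i[] =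
  \bigcap_(i in [set: 'I_d]) (@tnth _ R ^~ i @^-1` `]a i, b i[%classic).
  apply/seteqP; split => [u abu i _|u abu i] /=.
    by have := abu i; rewrite mxE.
  by rewrite mxE; exact: abu.
apply: fin_bigcap_measurable => // i _.
by rewrite -[X in measurable X]setTI; exact: measurable_tnth.
Qed.

(** An open set is the union of the rational open boxes inside it. They are enumerated by
    [unpickle], and an index that yields no such box contributes the empty set. *)
Lemma measurable_rV_open A : open A -> measurable_rV A.
Proof.
move=> oA; rewrite /measurable_rV.
pose box (q : {ffun 'I_d -> rat * rat}) : set 'rV[R]_d :=
  [set x | forall i, x ord0 i \in `]ratr (q i).1, ratr (q i).2[].
pose F k := if unpickle k is Some q then
  if pselect (box q `<=` A) then coords (box q) else set0 else set0.
have -> : coords A = \bigcup_k F k.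
  apply/seteqP; split => [u Au|u [k _]]; last first.
    by rewrite /F; case: unpickle => // q; case: pselect => //= qA /qA.
  have /nbhs_ballP[e e0 eA] : nbhs (\row_i tnth u i) A by exact: open_nbhs_nbhs.
  have /choice[a ua] : forall i, exists q : rat * rat,
      [/\ tnth u i - e < ratr q.1, ratr q.1 < tnth u i,
          tnth u i < ratr q.2 & ratr q.2 < tnth u i + e].
    move=> i; have /rat_in_itvoo[p] : tnth u i - e < tnth u i by rewrite ltrBlDr ltrDl.
    rewrite in_itv/= => /andP[? ?].
    have /rat_in_itvoo[q] : tnth u i < tnth u i + e by rewrite ltrDl.
    by rewrite in_itv/= => /andP[? ?]; exists (p, q).
  exists (pickle [ffun i => a i]) => //; rewrite /F pickleK.
  case: (pselect (box _ `<=` A)) => [? /=|nbA /=].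
    by move=> i; rewrite mxE ffunE in_itv/=; have [_ -> ->] := ua i.
  apply: nbA => x bx; apply: eA; split => // i j; rewrite (ord1 i) mxE.
  have := bx j; rewrite ffunE in_itv/= => /andP[? ?].
  by have [? ? ? ?] := ua j; rewrite /ball/= ltr_norml; apply/andP; split; lra.
apply: bigcupT_measurable => k; rewrite /F; case: unpickle => // q.
by case: pselect => ? //=; exact: measurable_rV_box.
Qed.

Lemma measurable_rVC A : measurable_rV A -> measurable_rV (~` A).
Proof. exact: measurableC. Qed.

Lemma measurable_rVD A B : measurable_rV A -> measurable_rV B -> measurable_rV (A `\` B).
Proof. exact: measurableD. Qed.

Lemma measurable_rV_closed A : closed A -> measurable_rV A.
Proof.
move=> cA; rewrite -(setCK A); apply: measurable_rVC; apply: measurable_rV_open.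
exact: closed_openC.
Qed.

Lemma measurable_rV_compact A : compact A -> measurable_rV A.
Proof.
by move=> cA; apply: measurable_rV_closed; apply: compact_closed cA; exact: norm_hausdorff.
Qed.

Lemma volume_ge0 A : measurable_rV A -> (0 <= volume A)%E.
Proof. by have [mu [muE _ _]] := lebesgue_tuple_measure R d; rewrite /volume muE. Qed.

Lemma le_volume A B : measurable_rV A -> measurable_rV B -> A `<=` B ->
  (volume A <= volume B)%E.
Proof.
have [mu [muE _ _]] := lebesgue_tuple_measure R d; rewrite /volume muE => mA mB AB.
by apply: le_measure; rewrite ?inE// => u; exact: AB.
Qed.

Lemma volumeD A B : measurable_rV A -> measurable_rV B -> B `<=` A ->
  volume A = (volume (A `\` B) + volume B)%E.
Proof.
have [mu [muE _ _]] := lebesgue_tuple_measure R d; rewrite /volume muE => mA mB BA.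
rewrite -measureU//; last by apply/seteqP; split => u [] [].
  congr (mu _); apply/seteqP; split => [u Au|u [[]//|/BA//]].
  by have [Bu|nBu] := pselect (B (\row_i tnth u i)); [right|left].
exact: measurable_rVD.
Qed.

Lemma coords_shift (c : 'rV[R]_d) A :
  coords [set x | A (x + c)] = shift_tuple [tuple c ord0 i | i < d] @^-1` coords A.
Proof.
apply/funext => u; rewrite /coords/=; congr (A _); apply/rowP => i.
by rewrite !mxE tnth_mktuple /= tnth_mktuple.
Qed.

Lemma volume_shift c A : measurable_rV A -> volume [set x | A (x + c)] = volume A.
Proof.
have [mu [muE mu_shift _]] := lebesgue_tuple_measure R d; rewrite /volume muE => mA.
by rewrite -/(coords [set x | A (x + c)]) coords_shift mu_shift.
Qed.

Lemma volume_compact A : compact A -> (volume A < +oo)%E.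
Proof.
move=> cA; have [M [_ /(_ (M + 1))AM]] := compact_bounded cA.
have {}AM u : A u -> `|u| <= M + 1 by apply: AM; rewrite ltrDl.
pose box : set 'rV[R]_d := [set x | forall i, x ord0 i \in `[- (M + 1), M + 1]].
have boxE : coords box = tuple_box (M + 1).
  by apply/seteqP; split => u /= h i; have := h i; rewrite mxE.
have mbox : measurable_rV box by rewrite /measurable_rV boxE; exact: measurable_tuple_box.
have [mu [muE _ mu_box]] := lebesgue_tuple_measure R d.
apply: (@le_lt_trans _ _ (volume box)).
  apply: le_volume => //; first exact: measurable_rV_compact.
  move=> x Ax i; rewrite in_itv/= -ler_norml; apply: le_trans (AM _ Ax).
  exact: normr_coord_le.
by rewrite /volume muE -/(coords box) boxE.
Qed.

(** As [fine] sends infinite values to [0], this is the volume only where that is finite, in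
    particular on compact sets ([volE]). *)
Definition vol A : R := fine (volume A).

Lemma volE A : compact A -> volume A = (vol A)%:E.
Proof.
move=> cA; rewrite fineK// ge0_fin_numE; first exact: volume_compact.
apply/volume_ge0; exact: measurable_rV_compact.
Qed.

Lemma vol_ge0 A : compact A -> 0 <= vol A.
Proof. by move=> cA; rewrite -lee_fin -volE//; apply: volume_ge0; exact: measurable_rV_compact. Qed.

Lemma le_vol A B : compact A -> compact B -> A `<=` B -> vol A <= vol B.
Proof.
move=> cA cB AB; rewrite -lee_fin -!volE//.
by apply: le_volume => //; exact: measurable_rV_compact.
Qed.

End volume.

(** * Volume of the sum with a zonotope *)

(** Cauchy's functional equation on the half-line, with monotonicity in place of continuity. *)
Lemma additive_monotone_linear (R : realType) (f : R -> R) :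
  (forall s t, 0 <= s -> 0 <= t -> f (s + t) = f s + f t) ->
  (forall s t, 0 <= s -> s <= t -> f s <= f t) ->
  forall s, 0 <= s -> f s = s * f 1.
Proof.
move=> fD f_le s s0.
have f0 : f 0 = 0 by have := fD 0 0 (lexx _) (lexx _); rewrite addr0 => h; lra.
have fMn n t : 0 <= t -> f (t *+ n) = f t *+ n.
  move=> t0; elim: n => [|n IH]; first by rewrite !mulr0n.
  by rewrite !mulrS fD// ?mulrn_wge0// IH.
have f1 : 0 <= f 1 by rewrite -f0; exact: f_le.
(* Both [f (s *+ n)] and [s *+ n * f 1] lie between [k * f 1] and [(k + 1) * f 1], where [k] is the
   integer part of [s *+ n]. A bound uniform in [n] forces the difference to vanish. *)
have bound n : `|f s - s * f 1| *+ n <= f 1.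
  have sn : 0 <= s *+ n by rewrite mulrn_wge0.
  have /andP[kl ku] := truncn_itv sn; set k := Num.truncn _ in kl ku.
  have : f k%:R <= f (s *+ n) by apply: f_le.
  have : f (s *+ n) <= f k.+1%:R by apply: f_le => //; exact: ltW.
  rewrite !fMn//.
  rewrite -normrMn mulrnBl -mulrnAl.
  have h1 : k%:R * f 1 <= s *+ n * f 1 by rewrite ler_wpM2r.
  have h2 : s *+ n * f 1 <= k.+1%:R * f 1 by rewrite ler_wpM2r// ltW.
  rewrite -[f 1 *+ k.+1]mulr_natl -[f 1 *+ k]mulr_natl.
  move: h2; rewrite -natr1 mulrDl mul1r => h2 h3 h4.
  by rewrite ler_norml; apply/andP; split; lra.
apply/eqP; rewrite -subr_eq0 -normr_le0 leNgt; apply/negP => gt0.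
have /archi_boundP : 0 <= f 1 / `|f s - s * f 1| by rewrite divr_ge0// ltW.
rewrite ltr_pdivrMr// mulr_natl => /lt_le_trans/(_ (bound _)).
by rewrite ltxx.
Qed.

Section zonotope.
Context (R : realType) (d : nat).
Implicit Types (K : set 'rV[R]_d) (e : 'rV[R]_d) (s t : R).

Definition segment e s : set 'rV[R]_d := [set l *: e | l in [set l : R | 0 <= l <= s]].

(** One-sided segments have lengths that add up, which yields linearity; symmetric ones give a
    zonotope the even support function [zsupp]. They differ by a translation, which volume
    ignores. *)
Definition symmetric_segment e : set 'rV[R]_d := [set l *: e | l in [set l : R | - 1 <= l <= 1]].

Lemma compact_scale_itv a b e : compact [set l *: e | l in [set l : R | a <= l <= b]].
Proof.
have -> : [set l : R | a <= l <= b] = `[a, b]%classic.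
  by apply/seteqP; split => l /=; rewrite in_itv.
apply: continuous_compact; last exact: segment_compact.
by apply: continuous_subspaceT; exact: scalel_continuous.
Qed.

Lemma convex_scale_itv a b e : is_convex [set l *: e | l in [set l : R | a <= l <= b]].
Proof.
move=> _ _ l [u /= /andP[au ub] <-] [v /= /andP[av vb] <-] l0 l1.
exists (l * u + (1 - l) * v); last by rewrite !scalerA -scalerDl.
rewrite /=.
have := ler_wpM2l l0 au; have := ler_wpM2l l0 ub.
have l1' : 0 <= 1 - l by lra.
have := ler_wpM2l l1' av; have := ler_wpM2l l1' vb.
by move=> ? ? ? ?; apply/andP; split; lra.
Qed.

Lemma subset_minkowski_sum (A B A' B' : set 'rV[R]_d) : A `<=` A' -> B `<=` B' ->
  minkowski_sum A B `<=` minkowski_sum A' B'.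
Proof. by move=> AA BB _ [a /AA ? [b /BB ? <-]]; exists a => //; exists b. Qed.

Lemma minkowski_sumA (A B C : set 'rV[R]_d) :
  minkowski_sum A (minkowski_sum B C) = minkowski_sum (minkowski_sum A B) C.
Proof.
apply/seteqP; split => [_ [a Aa [_ [b Bb [c Cc <-]] <-]]|_ [_ [a Aa [b Bb <-]] [c Cc <-]]].
  by exists (a + b); [exists a => //; exists b|exists c => //; rewrite addrA].
by exists a => //; exists (b + c); [exists b => //; exists c|rewrite addrA].
Qed.

Lemma minkowski_sumC (A B : set 'rV[R]_d) : minkowski_sum A B = minkowski_sum B A.
Proof.
by apply/seteqP; split => [_ [a Aa [b Bb <-]]|_ [a Aa [b Bb <-]]];
  exists b => //; exists a => //; rewrite addrC.
Qed.

Lemma minkowski_sum0 A : minkowski_sum A [set (0 : 'rV[R]_d)] = A.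
Proof.
apply/seteqP; split => [_ [a Aa [_ -> <-]]|a Aa]; first by rewrite addr0.
by exists a => //; exists 0 => //; rewrite addr0.
Qed.

(* On each line directed by [e], [K] is an interval [[a, b]], and both sides are the
   interval from [b + s] (excluded) to [b + s + t]. *)
Lemma minkowski_seg_shift K e s t : is_convex K -> 0 <= s -> 0 <= t ->
  [set x | (minkowski_sum K (segment e t) `\` K) (x + - s *: e)] =
  minkowski_sum K (segment e (s + t)) `\` minkowski_sum K (segment e s).
Proof.
move=> cK s0 t0; apply/seteqP; split => x.
  move=> [[k Kk [_ [l /= /andP[l0 lt] <-] kx]] nK].
  have xE : x = k + (l + s) *: e.
    by rewrite scalerDl addrA kx scaleNr subrK.
  split.
    exists k => //; exists ((l + s) *: e) => //; exists (l + s) => //=.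
    by apply/andP; split; lra.
  move=> [k' Kk' [_ [m /= /andP[m0 ms] <-] k'x]]; apply: nK.
  have [ms0|ms0] := eqVneq (l + (s - m)) 0.
    have -> : x + - s *: e = k' + (m - s) *: e.
      by rewrite -k'x -addrA -scalerDl.
    by have -> : m - s = 0 by [lra]; rewrite scale0r addr0.
  have pos : 0 < l + (s - m) by rewrite lt_neqAle eq_sym ms0/=; lra.
  (* The point in question is [k + l *: e], while [k' = k + (l + (s - m)) *: e]: it lies between two
     points of [K], and [p] is the weight of [k]. *)
  pose p := (s - m) / (l + (s - m)).
  have -> : x + - s *: e = p *: k + (1 - p) *: k'.
    have -> : k' = k + (l + s - m) *: e.
      by rewrite -(addrK (m *: e) k') k'x xE -addrA -scalerBl.
    rewrite xE scalerDr addrA -scalerDl.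
    have -> : p + (1 - p) = 1 by ring.
    rewrite scale1r -addrA; congr (_ + _).
    by rewrite scalerA -scalerDl; congr (_ *: _); rewrite /p; field.
  apply: cK => //; first by rewrite divr_ge0//; lra.
  by rewrite ler_pdivrMr// mul1r; lra.
move=> [[k Kk [_ [l /= /andP[l0 lst] <-] kx]] nK].
have sl : s < l.
  rewrite ltNge; apply/negP => ls; apply: nK; exists k => //.
  by exists (l *: e) => //; exists l => //=; rewrite l0.
split.
  exists k => //; exists ((l - s) *: e); first by exists (l - s) => //=; apply/andP; split; lra.
  by rewrite -kx -addrA -scalerDl.
move=> Kx; apply: nK; exists (x + - s *: e) => //; exists (s *: e).
  by exists s => //=; rewrite s0 lexx.
by rewrite scaleNr subrK.
Qed.

Lemma sub_minkowski_seg K e s : 0 <= s -> K `<=` minkowski_sum K (segment e s).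
Proof.
move=> s0 x Kx; exists x => //; exists 0; rewrite ?addr0//.
by exists 0; rewrite ?scale0r//= lexx.
Qed.

Lemma compact_seg K e s : compact K -> compact (minkowski_sum K (segment e s)).
Proof. by move=> cK; apply: compact_minkowski_sum => //; exact: compact_scale_itv. Qed.

Lemma vol_segD K e s t : compact K -> is_convex K -> 0 <= s -> 0 <= t ->
  vol (minkowski_sum K (segment e (s + t))) - vol K =
  (vol (minkowski_sum K (segment e s)) - vol K) + (vol (minkowski_sum K (segment e t)) - vol K).
Proof.
move=> cK convK s0 t0.
have cs u : compact (minkowski_sum K (segment e u)) by exact: compact_seg.
have ms u := measurable_rV_compact (cs u).
have mK := measurable_rV_compact cK.
have sub : minkowski_sum K (segment e s) `<=` minkowski_sum K (segment e (s + t)).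
  apply: subset_minkowski_sum => // _ [l /= /andP[l0 ls] <-].
  by exists l => //=; apply/andP; split; lra.
have h1 := volumeD (ms (s + t)) (ms s) sub.
have h2 := volumeD (ms t) mK (@sub_minkowski_seg K e t t0).
rewrite -(@volume_shift _ _ (- s *: e) (_ `\` _)) in h2; last exact: measurable_rVD.
rewrite minkowski_seg_shift// in h2.
move: h1 h2; set D := volume (_ `\` _).
rewrite !volE//.
case: D => [r| |].
- by rewrite -!EFinD => -[h1] [h2]; rewrite h1 h2; ring.
- by [].
- by [].
Qed.

Lemma vol_seg K e s : compact K -> is_convex K -> 0 <= s ->
  vol (minkowski_sum K (segment e s)) = vol K + s * (vol (minkowski_sum K (segment e 1)) - vol K).
Proof.
move=> cK convK s0; rewrite addrC; apply/eqP; rewrite -subr_eq; apply/eqP.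
apply: (additive_monotone_linear (f := fun s => vol (minkowski_sum K (segment e s)) - vol K)) => //.
  by move=> u v u0 v0; exact: vol_segD.
move=> u v u0 uv; rewrite lerB// le_vol//; try exact: compact_seg.
apply: subset_minkowski_sum => // _ [l /= /andP[l0 ls] <-].
by exists l => //=; apply/andP; split; lra.
Qed.

(** The symmetric segment of [u *: e] is a translate of the one-sided segment of length [2 * u], for
    which [vol_seg] is affine; the slope is read off at [u = 1]. *)
Lemma vol_sseg K e s : compact K -> is_convex K -> 0 <= s ->
  vol (minkowski_sum K (symmetric_segment (s *: e))) =
  vol K + s * (vol (minkowski_sum K (symmetric_segment e)) - vol K).
Proof.
move=> cK convK s0.
have symE u : 0 <= u ->
    vol (minkowski_sum K (symmetric_segment (u *: e))) = vol (minkowski_sum K (segment e (2 * u))).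
  move=> u0; rewrite /vol.
  rewrite -(@volume_shift _ _ (u *: e) (minkowski_sum K (segment e (2 * u)))); last first.
    by apply: measurable_rV_compact; exact: compact_seg.
  congr (fine (volume _)); apply/seteqP; split => [_ [k Kk [_ [l /= /andP[l0 l1] <-] <-]]|x].
    exists k => //; exists ((l + 1) * u *: e).
      exists ((l + 1) * u) => //=; apply/andP; split.
        by rewrite mulr_ge0//; lra.
      by rewrite ler_wpM2r//; lra.
    by rewrite mulrDl mul1r scalerDl scalerA addrA.
  move=> [k Kk [_ [l /= /andP[l0 l1] <-] kx]].
  have [u00|u00] := eqVneq u 0.
    move: l1 kx; rewrite u00 mulr0 !scale0r addr0 => l1.
    have -> : l = 0 by lra.
    rewrite scale0r addr0 => <-; exists k => //; exists 0; rewrite ?addr0//.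
    by exists 0; rewrite ?scaler0//=; apply/andP; split; lra.
  have upos : 0 < u by rewrite lt_neqAle eq_sym u00.
  exists k => //; exists ((l / u - 1) *: (u *: e)).
    exists (l / u - 1) => //=; apply/andP; split.
      by rewrite lerBrDr addNr divr_ge0.
    by rewrite lerBlDr ler_pdivrMr//; lra.
  rewrite scalerA mulrBl mul1r divfK// scalerBl addrA kx addrK//.
have := symE 1 ler01; rewrite scale1r mulr1 => ->; rewrite symE//.
have two : (0 : R) <= 2 by [].
have twos : 0 <= 2 * s by rewrite mulr_ge0.
rewrite (vol_seg e cK convK two) (vol_seg e cK convK twos).
by move: (vol _) (vol _) => u v; ring.
Qed.

Definition zonotope (l : seq 'rV[R]_d) : set 'rV[R]_d :=
  foldr (fun e Z => minkowski_sum (symmetric_segment e) Z) [set 0] l.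

Lemma compact_zonotope l : compact (zonotope l).
Proof.
elim: l => [|e l IH] /=; first exact: compact_set1.
by apply: compact_minkowski_sum => //; exact: compact_scale_itv.
Qed.

Lemma convex_zonotope l : is_convex (zonotope l).
Proof.
elim: l => [|e l IH] /=.
  by move=> _ _ a -> -> _ _ /=; rewrite !scaler0 addr0.
by apply: convex_minkowski_sum => //; exact: convex_scale_itv.
Qed.

(** The induction is for all [K] at once: [vol_sseg], applied to [K + sZ] for each fixed [s],
    involves the volumes of [K + sZ] and of [K + sZ + [-e, e]], and the latter is the same problem
    for the body [K + [-e, e]]. *)
Lemma vol_zonotope_poly l K : compact K -> is_convex K ->
  exists p : {poly R}, forall s, 0 <= s ->
    vol (minkowski_sum K (zonotope [seq s *: e | e <- l])) = p.[s].
Proof.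
elim: l K => [|e l IH] K cK convK.
  by exists (vol K)%:P => s s0 /=; rewrite minkowski_sum0 hornerC.
have [p pE] := IH K cK convK.
have cKe : compact (minkowski_sum K (symmetric_segment e)).
  by apply: compact_minkowski_sum => //; exact: compact_scale_itv.
have [q qE] : exists q : {poly R}, forall s, 0 <= s ->
    vol (minkowski_sum (minkowski_sum K (symmetric_segment e))
                       (zonotope [seq s *: e | e <- l])) = q.[s].
  by apply: IH => //; apply: convex_minkowski_sum => //; exact: convex_scale_itv.
exists (p + 'X * (q - p)) => s s0 /=.
rewrite (minkowski_sumC (symmetric_segment _)) minkowski_sumA vol_sseg//; first last.
- by apply: convex_minkowski_sum => //; exact: convex_zonotope.
- by apply: compact_minkowski_sum => //; exact: compact_zonotope.
rewrite -minkowski_sumA (minkowski_sumC (zonotope _)) minkowski_sumA pE// qE//.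
by rewrite !hornerE.
Qed.

End zonotope.

(** * Approximation of the ball by zonotopes *)

Section approx.
Context (R : realType) (d : nat).
Implicit Types (x y z u e : 'rV[R]_d) (l : seq 'rV[R]_d).

(* The support function of [zonotope l]. *)
Definition zsupp l x : R := \sum_(e <- l) `|dot e x|.

Lemma dot_zonotope_le l z x : zonotope l z -> dot z x <= zsupp l x.
Proof.
rewrite /zsupp; elim: l z => [|e l IH] z /=; first by move=> ->; rewrite dot0l big_nil.
move=> [_ [c /= /andP[c1 c2] <-] [w zw <-]]; rewrite big_cons dotDl lerD ?IH// dotZl.
apply: le_trans (ler_norm _) _; rewrite normrM ler_piMl// ler_norml; apply/andP; split; lra.
Qed.

Lemma zonotope_supp l x : exists2 z, zonotope l z & dot z x = zsupp l x.
Proof.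
rewrite /zsupp; elim: l => [|e l [z zl zx]] /=; first by exists 0; rewrite ?dot0l ?big_nil.
(* Taking the sign of [dot e x] as coefficient attains the maximum on each summand. *)
exists (Num.sg (dot e x) *: e + z).
  exists (Num.sg (dot e x) *: e); last by exists z.
  exists (Num.sg (dot e x)) => //=.
  by case: sgrP => _; apply/andP; split; lra.
by rewrite dotDl dotZl zx big_cons [in RHS]normrEsg.
Qed.

(** Each point [z] is tested in its own direction: [dot z z] is at most the support function at
    [z]. *)
Lemma zonotope_sub_cball l a : 0 <= a -> (forall x, zsupp l x <= a * enorm x) ->
  zonotope l `<=` cball a.
Proof.
move=> a0 la z zl; rewrite /cball/=.
have [->|z0] := eqVneq z 0; first by rewrite enorm0.
rewrite -(ler_pM2r (enorm_gt0 z0)) -expr2 sqr_enorm.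
exact: le_trans (dot_zonotope_le _ zl) (la z).
Qed.

Lemma nearest_point (A : set 'rV[R]_d) y : compact A -> A !=set0 ->
  exists2 z, A z & forall z', A z' -> enorm (y - z) <= enorm (y - z').
Proof.
move=> cA A0.
have [|z Az zmin] := @compact_EVT_min _ R (fun z => enorm (y - z)) A A0 cA.
  by apply: continuous_subspaceT; exact: enormB_continuous.
by exists z; [rewrite inE in Az|move=> z' Az'; apply: zmin; rewrite inE].
Qed.

Lemma dot_sqrBZ x y (c : R) :
  dot (x - c *: y) (x - c *: y) = dot x x - 2 * c * dot y x + c ^+ 2 * dot y y.
Proof. by rewrite !(dotBl, dotBr, dotZl, dotZr) (dotC x y); ring. Qed.

Lemma nearest_point_dot (A : set 'rV[R]_d) y z : is_convex A -> A z ->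
  (forall z', A z' -> enorm (y - z) <= enorm (y - z')) ->
  forall z', A z' -> dot (z' - z) (y - z) <= 0.
Proof.
move=> cA Az zmin z' Az'.
set p := dot _ _; rewrite leNgt; apply/negP => p0.
pose q := dot (z' - z) (z' - z).
have q0 : 0 <= q by exact: dot_ge0.
(* Moving from [z] towards [z'] by [c] changes the squared distance to [y] by [c * (c * q - 2 * p)].
   This [c] is at most [1], allows [q = 0], and makes [c * q < p], so the change is negative. *)
pose c := p / (p + q).
have pq : 0 < p + q by lra.
have c0 : 0 < c by rewrite divr_gt0.
have c1 : c <= 1 by rewrite ler_pdivrMr// mul1r; lra.
have := zmin _ (cA _ _ c Az' Az (ltW c0) c1).
have -> : y - (c *: z' + (1 - c) *: z) = (y - z) - c *: (z' - z).
  by apply/rowP => i; rewrite !mxE; ring.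
rewrite -(@ler_pXn2r _ 2)// ?nnegrE ?enorm_ge0// !sqr_enorm.
rewrite dot_sqrBZ -/p -/q.
move=> h; have : 0 <= c * (c * q - 2 * p) by lra.
rewrite pmulr_rge0// /c mulrAC subr_ge0 ler_pdivlMr//; nra.
Qed.

(** Separation: for [y] outside, with nearest point [z], the whole zonotope lies in
    [dot _ (y - z) <= dot z (y - z)]. That bound is below [b * enorm (y - z)], hence below the value
    of the support function, which is attained. *)
Lemma cball_sub_zonotope l b : (forall x, b * enorm x <= zsupp l x) -> cball b `<=` zonotope l.
Proof.
move=> bl y; rewrite /cball/= => yb; apply: contrapT => nyl.
have zl0 : zonotope l !=set0.
  by have [z zl _] := zonotope_supp l 0; exists z.
have [z zl zmin] := nearest_point y (@compact_zonotope _ _ l) zl0.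
have dz := nearest_point_dot (@convex_zonotope _ _ l) zl zmin.
have u0 : y - z != 0 by apply/eqP => /subr0_eq yz; apply: nyl; rewrite yz.
have [w wl wE] := zonotope_supp l (y - z).
have h1 := dz _ wl; have h2 := bl (y - z); rewrite -wE in h2.
have h3 : dot z (y - z) = dot y (y - z) - enorm (y - z) ^+ 2.
  by rewrite sqr_enorm [dot (y - z) _]dotBl; ring.
have h4 := dot_le y (y - z).
have h5 := enorm_gt0 u0.
move: h1; rewrite dotBl h3 => h1.
have h6 : 0 < enorm (y - z) ^+ 2 by rewrite exprn_gt0.
have h7 : enorm y * enorm (y - z) <= b * enorm (y - z) by rewrite ler_pM2r.
lra.
Qed.

Lemma zsuppZ l c x : zsupp l (c *: x) = `|c| * zsupp l x.
Proof. by rewrite /zsupp mulr_sumr; apply: eq_bigr => e _; rewrite dotZr normrM. Qed.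

Lemma zsuppD l x y : zsupp l (x + y) <= zsupp l x + zsupp l y.
Proof.
by rewrite /zsupp -big_split; apply: ler_sum => e _ /=; rewrite dotDr ler_normD.
Qed.

Lemma zsupp_scale l c x : zsupp [seq c *: e | e <- l] x = `|c| * zsupp l x.
Proof. by rewrite /zsupp big_map mulr_sumr; apply: eq_bigr => e _; rewrite dotZl normrM. Qed.

(* At [u = 0] this is the identity, since the library sets [x / 0 = 0]. *)
Definition reflect u x := x - (2 * dot x u / dot u u) *: u.

Lemma dot_reflect u x y : dot (reflect u x) y = dot x (reflect u y).
Proof. by rewrite /reflect dotBl dotBr dotZl dotZr (dotC u y); ring. Qed.

Lemma reflectB u x y : reflect u (x - y) = reflect u x - reflect u y.
Proof. by rewrite /reflect dotBl; apply/rowP => i; rewrite !mxE; ring. Qed.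

Lemma reflectK u : involutive (reflect u).
Proof.
move=> x; rewrite /reflect.
have [->|u0] := eqVneq u 0; first by rewrite !scaler0 !subr0.
have uu : dot u u != 0 by rewrite -sqr_enorm expf_neq0// gt_eqF// enorm_gt0.
rewrite dotBl dotZl; apply/rowP => i; rewrite !mxE; by field.
Qed.

Lemma enorm_reflect u x : enorm (reflect u x) = enorm x.
Proof. by rewrite !enormE dot_reflect reflectK. Qed.

(** For equal norms, the hyperplane through the origin orthogonal to [x - y] bisects the segment
    from [x] to [y]. *)
Lemma reflect_swap x y : enorm x = enorm y -> reflect (x - y) x = y.
Proof.
move=> xy; have [->|u0] := eqVneq x y.
  by rewrite subrr /reflect scaler0 subr0.
have uu : dot (x - y) (x - y) != 0.
  by rewrite -sqr_enorm expf_neq0// gt_eqF// enorm_gt0// subr_eq0.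
rewrite /reflect; have -> : 2 * dot x (x - y) = dot (x - y) (x - y).
  rewrite dotBr [in RHS]dotBl !dotBr -(sqr_enorm y) -xy sqr_enorm (dotC y x); ring.
by rewrite divff// scale1r opprB addrC subrK.
Qed.

Lemma zsupp_reflect l u x : zsupp [seq reflect u e | e <- l] x = zsupp l (reflect u x).
Proof. by rewrite /zsupp big_map; apply: eq_bigr => e _; rewrite dot_reflect. Qed.

Lemma zsupp_flatten ls x : zsupp (flatten ls) x = \sum_(l <- ls) zsupp l x.
Proof.
rewrite /zsupp; elim: ls => [|l ls IH] /=; first by rewrite !big_nil.
by rewrite big_cat big_cons IH.
Qed.

Lemma sphere_net (delta : R) : 0 < delta ->
  exists2 N : seq 'rV[R]_d, (forall y, y \in N -> enorm y = 1) &
    forall x, enorm x = 1 -> exists2 y, y \in N & enorm (x - y) < delta.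
Proof.
move=> d0; pose S : set 'rV[R]_d := [set x | enorm x = 1].
have cS : compact S.
  apply: (subclosed_compact _ (@compact_cball _ _ 1)); last by move=> x; rewrite /cball /S /= => ->.
  rewrite (_ : S = @enorm R d @^-1` [set 1])//.
  by apply: closed_comp; [move=> x _; exact: enorm_continuous|exact: closed_eq].
move: cS; rewrite compact_cover => /(_ _ S (fun y => [set x | enorm (x - y) < delta])).
case.
- move=> y _; apply/open_enormP => x /= xy.
  exists (delta - enorm (x - y)); first by rewrite subr_gt0.
  move=> z xz; have := ler_enormB z x y; rewrite (enormB z x); lra.
- by move=> x Sx; exists x => //=; rewrite subrr enorm0.
move=> D DS cov; exists (finmap.enum_fset D).
  by move=> y yD; have := DS y yD; rewrite inE.
by move=> x /cov[y /= yD xy]; exists y.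
Qed.

Lemma zsupp_ge_homo l b : (forall x, enorm x = 1 -> b <= zsupp l x) ->
  forall x, b * enorm x <= zsupp l x.
Proof.
move=> bl x; have [->|x0] := eqVneq x 0.
  by rewrite enorm0 mulr0; apply: sumr_ge0.
have xp := enorm_gt0 x0.
have x1 : enorm ((enorm x)^-1 *: x) = 1.
  by rewrite enormZ gtr0_norm ?invr_gt0// mulVf// gt_eqF.
have := bl _ x1; rewrite zsuppZ gtr0_norm ?invr_gt0// ler_pdivlMl//.
by rewrite mulrC.
Qed.

Lemma zsupp_le_homo l a : (forall x, enorm x = 1 -> zsupp l x <= a) ->
  forall x, zsupp l x <= a * enorm x.
Proof.
move=> bl x; have [->|x0] := eqVneq x 0.
  rewrite enorm0 mulr0 /zsupp big1// => e _; by rewrite dot0r normr0.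
have xp := enorm_gt0 x0.
have x1 : enorm ((enorm x)^-1 *: x) = 1.
  by rewrite enormZ gtr0_norm ?invr_gt0// mulVf// gt_eqF.
have := bl _ x1; rewrite zsuppZ gtr0_norm ?invr_gt0// ler_pdivrMl//.
by rewrite mulrC.
Qed.

(** The standard basis gives the sum of the absolute values of the coordinates. This provides a
    first finite ratio for the infimum in [zsupp_approx]. *)
Lemma zsupp_basis : exists l, forall x, enorm x <= zsupp l x <= d%:R * enorm x.
Proof.
exists [seq delta_mx ord0 i | i <- enum 'I_d] => x.
have -> : zsupp [seq delta_mx ord0 i | i <- enum 'I_d] x = \sum_(i < d) `|x ord0 i|.
  rewrite /zsupp big_map big_enum; apply: eq_bigr => i _; congr `|_|.
  rewrite dotE (bigD1 i)//= mxE !eqxx mul1r big1 ?addr0// => j ji.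
  by rewrite mxE (negbTE ji) andbF mul0r.
apply/andP; split.
  rewrite -(@ler_pXn2r _ 2)// ?nnegrE ?enorm_ge0 ?sumr_ge0//.
  rewrite sqr_enorm dotE expr2 mulr_suml; apply: ler_sum => i _.
  rewrite -expr2 -[_ ^+ 2]ger0_norm ?sqr_ge0// normrX expr2 ler_wpM2l//.
  by rewrite (bigD1 i)//= lerDl sumr_ge0.
apply: (@le_trans _ _ (\sum_(i < d) enorm x)).
  by apply: ler_sum => i _; exact: normr_le_enorm_coord.
by rewrite sumr_const card_ord mulr_natl.
Qed.

(* [rho] is thought of as the best ratio [a] achieved by zonotopes.  If the support function
   stays above [1 + eta] on the sphere, rescaling improves it; otherwise it is small near some
   [x0], and averaging over reflections sending the points of a finite net to [x0] spreads this
   defect over the whole sphere. *)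
Lemma zsupp_approx_step (rho : R) : 1 < rho -> exists2 e, 0 < e &
  forall l a, rho <= a -> a < rho + e -> (forall x, enorm x <= zsupp l x <= a * enorm x) ->
  exists l' a', a' < rho /\ forall x, enorm x <= zsupp l' x <= a' * enorm x.
Proof.
(* For [a < rho + 1] both [eta] and [a * delta] are at most [(rho - 1) / 4], so that
   [1 + eta + a * delta] stays below [a] by at least [(rho - 1) / 2]. *)
move=> rho1; pose eta := (rho - 1) / 4; pose delta := (rho - 1) / (4 * (rho + 1)).
have eta0 : 0 < eta by rewrite divr_gt0// subr_gt0.
have delta0 : 0 < delta by rewrite divr_gt0// ?subr_gt0// mulr_gt0//; lra.
have [N N1 Ndelta] := sphere_net delta0.
pose n : R := (size N)%:R.
have n0 : 0 <= n by rewrite ler0n.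
(* The bound [1] gives [a < rho + 1]; [eta] makes rescaling by [1 + eta] bring the ratio below
   [rho]; the last keeps the excess of [a] over [rho] smaller than the gain [(rho - 1) / 2] once
   shared among [n] points. *)
pose e := Num.min (Num.min 1 eta) ((rho - 1) / (2 * (n + 1))).
have e0 : 0 < e by rewrite !lt_min ltr01 eta0 divr_gt0// ?subr_gt0//; lra.
exists e => // l a rhoa ae la.
have ae1 : a < rho + 1 by apply: lt_le_trans ae _; rewrite lerD2l !ge_min lexx.
have aeeta : a < rho + eta by apply: lt_le_trans ae _; rewrite lerD2l !ge_min lexx orbT.
have aen : a < rho + (rho - 1) / (2 * (n + 1)).
  by apply: lt_le_trans ae _; rewrite lerD2l !ge_min lexx orbT.
have [big|] := pselect (forall x, enorm x = 1 -> 1 + eta <= zsupp l x).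
  exists [seq (1 + eta)^-1 *: e | e <- l], (a / (1 + eta)).
  have eta1 : 0 < 1 + eta by lra.
  split; first by rewrite ltr_pdivrMr//; nra.
  move=> x; rewrite zsupp_scale gtr0_norm ?invr_gt0//.
  rewrite ler_pdivlMl// zsupp_ge_homo//= ler_pdivrMl// mulrA (mulrC _ (a / _)) divfK ?gt_eqF//.
  by have /andP[] := la x.
move=> /existsNP[x0 /not_implyP[x01 /negP]]; rewrite -ltNge => x0eta.
have [y0 y0N _] := Ndelta _ x01.
have npos : 0 < n by rewrite ltr0n; case: (N) y0N.
pose l' := flatten [seq [seq n^-1 *: f | f <- [seq reflect (y - x0) f | f <- l]] | y <- N].
have l'E x : zsupp l' x = n^-1 * \sum_(y <- N) zsupp l (reflect (y - x0) x).
  rewrite zsupp_flatten big_map mulr_sumr; apply: eq_bigr => y _.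
  by rewrite zsupp_scale zsupp_reflect gtr0_norm// invr_gt0.
have l_ub x : enorm x = 1 -> zsupp l x <= a.
  by move=> x1; have /andP[_] := la x; rewrite x1 mulr1.
have a0 : 0 <= a by apply: le_trans (l_ub _ x01); exact: sumr_ge0.
(* In the average over the net, the term of a net point close to [x] is at most
   [1 + eta + a * delta]; the other [n - 1] are bounded by [a]. *)
exists l', (a - (a - (1 + eta + a * delta)) / n); split.
  have gap : (rho - 1) / 2 <= a - (1 + eta + a * delta).
    have : a * delta <= (rho + 1) * delta by rewrite ler_wpM2r// ltW.
    have -> : (rho + 1) * delta = (rho - 1) / 4 by rewrite /delta; field; lra.
    rewrite /eta; lra.
  have : (rho - 1) / 2 / n <= (a - (1 + eta + a * delta)) / n.
    by rewrite ler_wpM2r// invr_ge0.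
  have : (rho - 1) / (2 * (n + 1)) <= (rho - 1) / 2 / n.
    rewrite -mulrA -invfM; apply: ler_wpM2l; first lra.
    by rewrite lef_pV2 ?posrE; lra.
  lra.
move=> x; apply/andP; split.
  rewrite -[leLHS]mul1r; apply: zsupp_ge_homo => {}x x1.
  rewrite l'E ler_pdivlMl// mulr1.
  have -> : n = \sum_(y <- N) 1 by rewrite big_const_seq count_predT iter_addr_0.
  apply: ler_sum => y _; rewrite -x1 -(enorm_reflect (y - x0) x).
  by have /andP[] := la (reflect (y - x0) x).
apply: zsupp_le_homo => {}x x1.
have [y yN xy] := Ndelta _ x1.
rewrite l'E ler_pdivrMl// (big_rem y)//=.
have h1 : zsupp l (reflect (y - x0) x) <= 1 + eta + a * delta.
  have -> : reflect (y - x0) x = x0 + (reflect (y - x0) x - x0).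
    by apply/rowP => i; rewrite !mxE; ring.
  apply: le_trans (zsuppD _ _ _) _; rewrite lerD ?(ltW x0eta)//.
  have -> : reflect (y - x0) x - x0 = reflect (y - x0) (x - y).
    by rewrite reflectB (reflect_swap (x := y)) // x01; exact: N1.
  have /andP[_ /le_trans] := la (reflect (y - x0) (x - y)); apply.
  by rewrite enorm_reflect ler_wpM2l// ltW.
have h2 : \sum_(z <- rem y N) zsupp l (reflect (z - x0) x) <= (n - 1) * a.
  apply: (@le_trans _ _ (\sum_(z <- rem y N) a)).
    by apply: ler_sum => z _; apply: l_ub; rewrite enorm_reflect.
  rewrite big_const_seq count_predT iter_addr_0 size_rem// -mulr_natl.
  by rewrite -subn1 natrB//; case: (N) y0N.
have -> : n * (a - (a - (1 + eta + a * delta)) / n) = (1 + eta + a * delta) + (n - 1) * a.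
  by field; rewrite gt_eqF.
exact: lerD.
Qed.

(** If the infimum of the ratios exceeded [1], a ratio close enough to it could be improved to one
    below it. *)
Lemma zsupp_approx (eps : R) : 0 < eps ->
  exists l, forall x, enorm x <= zsupp l x <= (1 + eps) * enorm x.
Proof.
move=> eps0.
(* The clause [1 <= a] bounds [S] below even in dimension [0], where every real is a ratio; hence
   the [Num.max 1] around new ratios. *)
pose S := [set a : R | 1 <= a /\ exists l, forall x, enorm x <= zsupp l x <= a * enorm x].
have hS : has_inf S.
  split; last by exists 1 => a [].
  have [l lP] := zsupp_basis; exists (Num.max 1 d%:R); split; first by rewrite le_max lexx.
  exists l => x; have /andP[-> /le_trans] := lP x; apply.
  by rewrite ler_wpM2r ?enorm_ge0// le_max lexx orbT.
have rho1 : 1 <= inf S by apply: lb_le_inf hS.1 _ => a [].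
have [rho_gt1|rho_le1] := ltP 1 (inf S); last first.
  have [a [a1 [l lP]] ae] := inf_adherent eps0 hS.
  exists l => x; have /andP[-> /le_trans] := lP x; apply.
  by rewrite ler_wpM2r ?enorm_ge0//; lra.
have [e e0 step] := zsupp_approx_step rho_gt1.
have [a [a1 [l lP]] ae] := inf_adherent e0 hS.
have [l' [a' [a'rho l'P]]] := step l a (ge_inf hS.2 (conj a1 (ex_intro _ l lP))) ae lP.
have : inf S <= Num.max 1 a'.
  apply: (ge_inf hS.2); split; first by rewrite le_max lexx.
  exists l' => x; have /andP[-> /le_trans] := l'P x; apply.
  by rewrite ler_wpM2r ?enorm_ge0// le_max lexx orbT.
by rewrite le_max leNgt rho_gt1/= leNgt a'rho.
Qed.

End approx.

(** * Balls touching a smooth hypersurface *)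

Section smooth.
Context (R : realType) (n : nat).
Implicit Types (x y p q v : 'rV[R]_n.+1) (f : 'rV[R]_n.+1 -> R).

Lemma is_derive_line f x v (t : R) : derivable f (x + t *: v) v ->
  is_derive t 1 (fun s : R => f (x + s *: v)) ('D_v f (x + t *: v)).
Proof.
move=> dfv.
have E : (fun h : R =>
    h^-1 *: (((fun s : R => f (x + s *: v)) \o shift t) (h *: 1) - f (x + t *: v))) =
  (fun h => h^-1 *: ((f \o shift (x + t *: v)) (h *: v) - f (x + t *: v))).
  apply/funext => h /=; congr (_ *: (f _ - _)).
  by rewrite [h *: 1]mulr1 scalerDl addrCA addrA.
split; first by rewrite /derivable E.
by rewrite /derive E.
Qed.

Lemma MVT_line_pos f x v (h : R) : 0 <= h ->
  (forall s, 0 <= s <= h -> derivable f (x + s *: v) v) ->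
  exists2 s, 0 <= s <= h & f (x + h *: v) - f x = h * 'D_v f (x + s *: v).
Proof.
move=> h0 df.
pose phi (s : R) : R := f (x + s *: v); pose psi (s : R) : R := 'D_v f (x + s *: v).
have dd (s : R) : s \in `[0, h] -> is_derive s 1 phi (psi s).
  by rewrite in_itv/= => /df; exact: is_derive_line.
have phi_cont : {within `[0, h], continuous phi}.
  by apply: derivable_within_continuous => s /dd [].
have dd' (s : R) : s \in `]0, h[ -> is_derive s 1 phi (psi s).
  by rewrite in_itv/= => /andP[s0 sh]; apply: dd; rewrite in_itv/= !ltW.
have [s] := MVT_segment h0 dd' phi_cont.
rewrite in_itv/= /phi /psi scale0r addr0 subr0 => sh sE; exists s => //.
by rewrite sE mulrC.
Qed.

Definition between0 (s h : R) : bool := (0 <= s <= h) || (h <= s <= 0).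

Lemma MVT_line f x v (h : R) :
  (forall s, between0 s h -> derivable f (x + s *: v) v) ->
  exists2 s, between0 s h & f (x + h *: v) - f x = h * 'D_v f (x + s *: v).
Proof.
move=> df; have [h0|/ltW h0] := leP 0 h.
  have [s s0h|s s0h sE] := @MVT_line_pos f x v h h0.
    by apply: df; rewrite /between0 s0h.
  by exists s => //; rewrite /between0 s0h.
have h0' : 0 <= - h by rewrite oppr_ge0.
have [s /andP[s0 sh]|s /andP[s0 sh]] := @MVT_line_pos f (x + h *: v) v (- h) h0'.
  rewrite -addrA -scalerDl; apply: df.
  by apply/orP; right; apply/andP; split; lra.
rewrite scaleNr addrK -addrA -scalerDl => sE.
exists (h + s); first by apply/orP; right; apply/andP; split; lra.
by rewrite -opprB sE mulNr opprK.
Qed.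

(** Coordinates are changed one at a time, with the one-variable theorem on each edge, so partial
    derivatives suffice. Balls are those of the sup norm, so the broken line stays inside. *)
Lemma mean_value_rV f p (r : R) x y :
  (forall z i, ball p r z -> derivable f z (delta_mx ord0 i)) ->
  ball p r x -> ball p r y ->
  exists xi : 'I_n.+1 -> 'rV[R]_n.+1,
    (forall k, ball p r (xi k) /\ `|xi k - x| <= `|y - x|) /\
    f y - f x = \sum_k (y ord0 k - x ord0 k) * 'D_(delta_mx ord0 k) f (xi k).
Proof.
move=> df bx by_.
pose z (k : nat) : 'rV[R]_n.+1 := \row_i (if (i < k)%N then y ord0 i else x ord0 i).
have zS (k : 'I_n.+1) : z k.+1 = z k + (y ord0 k - x ord0 k) *: delta_mx ord0 k.
  apply/rowP => i; rewrite !mxE eqxx/= ltnS leq_eqVlt.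
  have [->|ik] := eqVneq i k; first by rewrite eqxx/= ltnn mulr1 addrC subrK.
  by rewrite mulr0 addr0 (negbTE (ik : (i : nat) != k)).
have zs (k : 'I_n.+1) (s : R) : between0 s (y ord0 k - x ord0 k) ->
    ball p r (z k + s *: delta_mx ord0 k) /\ `|z k + s *: delta_mx ord0 k - x| <= `|y - x|.
  move=> sb; have wE i : (z k + s *: delta_mx ord0 k) ord0 i =
      if i == k then x ord0 k + s else if (i < k)%N then y ord0 i else x ord0 i.
    rewrite !mxE eqxx/=; have [->|_] := eqVneq i k; first by rewrite ltnn mulr1.
    by rewrite mulr0 addr0.
  have [r0 bx'] := bx; have [_ by'] := by_.
  split.
    split=> // a i; rewrite (ord1 a) wE.
    case: eqVneq => [ik|_]; last by case: ifP => _; [exact: by'|exact: bx'].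
    have := bx' ord0 k; have := by' ord0 k.
    rewrite /ball /= !ltr_norml => /andP[? ?] /andP[? ?].
    rewrite ik.
    by case/orP: sb => /andP[? ?]; apply/andP; split; lra.
  rewrite [leLHS]/Num.norm /= mx_normrE; apply/bigmax_leP; split => //= -[a i] _ /=.
  have ->: (z k + s *: delta_mx ord0 k - x) a i = (z k + s *: delta_mx ord0 k) ord0 i - x ord0 i.
    by rewrite (ord1 a) [LHS]mxE; congr (_ + _); rewrite mxE.
  have := normr_coord_le (y - x) i; rewrite [X in `|X|]mxE [X in _ + X]mxE.
  apply: le_trans; rewrite wE.
  case: eqVneq => [->|_]; last by case: ifP => // _; rewrite subrr normr0.
  rewrite addrAC subrr add0r.
  case/orP: sb => /andP[s1 s2]; first by rewrite !ger0_norm//; exact: le_trans s2.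
  by rewrite !ler0_norm ?lerN2//; exact: le_trans s2.
have /choice[xi xiP] : forall k : 'I_n.+1, exists w, (ball p r w /\ `|w - x| <= `|y - x|) /\
   f (z k.+1) - f (z k) = (y ord0 k - x ord0 k) * 'D_(delta_mx ord0 k) f w.
  move=> k; pose h := y ord0 k - x ord0 k.
  have [s /zs[sb _]|s /zs sb sE] := @MVT_line f (z k) (delta_mx ord0 k) h; first exact: df.
  by exists (z k + s *: delta_mx ord0 k); split => //; rewrite zS.
exists xi; split; first by move=> k; exact: (xiP k).1.
have z0 : z 0%N = x by apply/rowP => i; rewrite mxE.
have zn : z n.+1 = y by apply/rowP => i; rewrite mxE ltn_ord.
rewrite -{1}zn -{1}z0 -(telescope_sumr (fun k => f (z k)))// big_mkord.
by apply: eq_bigr => k _; exact: (xiP k).2.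
Qed.

Lemma near_ball_sub p (A : set 'rV[R]_n.+1) : nbhs p A ->
  \forall r \near (0 : R)^'+, ball p r `<=` A.
Proof.
move=> /nbhs_ballP[e e0 eA]; near=> r.
apply: subset_trans eA; apply: le_ball.
by near: r; exact: nbhs_right_le.
Unshelve. all: by end_near. Qed.

Lemma class_C1_lipschitz (U : set 'rV[R]_n.+1) f p : open U -> U p -> class_C 1 U f ->
  exists2 L, 0 <= L & \forall r \near (0 : R)^'+, forall x y,
    ball p r x -> ball p r y -> `|f y - f x| <= L * `|y - x|.
Proof.
move=> oU Up [_ Cf].
pose L := \sum_(i < n.+1) (`|'D_(delta_mx ord0 i) f p| + 1).
exists L; first by apply: sumr_ge0 => i _; rewrite addr_ge0.
have nbU : \forall r \near (0 : R)^'+, ball p r `<=` U.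
  by apply: near_ball_sub; exact: open_nbhs_nbhs.
have nbD : \forall r \near (0 : R)^'+, forall i : 'I_n.+1, forall z, ball p r z ->
    `|'D_(delta_mx ord0 i) f z| <= `|'D_(delta_mx ord0 i) f p| + 1.
  apply: filter_forall => i.
  have [_ [/(_ _ Up) cD _]] := Cf i.
  apply: (@near_ball_sub p
    [set z | `|'D_(delta_mx ord0 i) f z| <= `|'D_(delta_mx ord0 i) f p| + 1]).
  have /(@cvgrPdist_lt _ _ _ _ (nbhs_filter p))/(_ 1 ltr01) := cD.
  apply: filterS => z /= pz.
  rewrite -lerBlDl; apply: le_trans (ltW pz).
  by rewrite distrC; apply: le_trans (ler_dist_dist _ _); exact: ler_norm.
near=> r => x y bx by_.
have [|xi [xiP ->]] := @mean_value_rV f p r x y _ bx by_.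
  move=> z i bz; have [dU _] := Cf i; apply: dU.
  by have : ball p r `<=` U by [near: r]; exact.
rewrite /L mulr_suml; apply: le_trans (ler_norm_sum _ _ _) _.
apply: ler_sum => k _; rewrite normrM mulrC; apply: ler_pM => //.
  by have := near nbD r; apply => //; exact: (xiP k).1.
by have := normr_coord_le (y - x) k; rewrite [X in `|X|]mxE [X in _ + X]mxE.
Unshelve. all: by end_near. Qed.

Definition grad f x : 'rV[R]_n.+1 := \row_i 'D_(delta_mx ord0 i) f x.

(** The mean value formula involves partial derivatives at points near [x]; these are Lipschitz,
    which costs a second factor [|y - x|]. The base point [x] is free to move, so that [C] serves
    all points of a hypersurface near [p]. *)
Lemma class_C2_taylor (U : set 'rV[R]_n.+1) f p : open U -> U p -> class_C 2 U f ->
  exists2 C, 0 <= C & \forall r \near (0 : R)^'+, forall x y,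
    ball p r x -> ball p r y -> `|f y - f x - dot (grad f x) (y - x)| <= C * `|y - x| ^+ 2.
Proof.
move=> oU Up [_ Cf].
have /choice[L LP] : forall i : 'I_n.+1, exists L, 0 <= L /\ \forall r \near (0 : R)^'+, forall x y,
    ball p r x -> ball p r y ->
    `|'D_(delta_mx ord0 i) f y - 'D_(delta_mx ord0 i) f x| <= L * `|y - x|.
  move=> i; have [_ C1] := Cf i.
  by have [L L0 LP] := class_C1_lipschitz oU Up C1; exists L.
exists (\sum_i L i); first by apply: sumr_ge0 => i _; exact: (LP i).1.
have nbU : \forall r \near (0 : R)^'+, ball p r `<=` U.
  by apply: near_ball_sub; exact: open_nbhs_nbhs.
have nbL : \forall r \near (0 : R)^'+, forall i, forall x y, ball p r x -> ball p r y ->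
    `|'D_(delta_mx ord0 i) f y - 'D_(delta_mx ord0 i) f x| <= L i * `|y - x|.
  by apply: filter_forall => i; exact: (LP i).2.
near=> r => x y bx by_.
have [|xi [xiP ->]] := @mean_value_rV f p r x y _ bx by_.
  move=> z i bz; have [dU _] := Cf i; apply: dU.
  by have : ball p r `<=` U by [near: r]; exact.
rewrite dotE -sumrB mulr_suml; apply: le_trans (ler_norm_sum _ _ _) _.
apply: ler_sum => k _; rewrite !mxE mulrC -mulrBl normrM expr2 mulrA; apply: ler_pM => //.
  have [bxi xiyx] := xiP k.
  apply: (@le_trans _ _ (L k * `|xi k - x|)); last by rewrite ler_wpM2l// (LP k).1.
  by have := near nbL r; apply.
by have := normr_coord_le (y - x) k; rewrite [X in `|X|]mxE [X in _ + X]mxE.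
Unshelve. all: by end_near. Qed.

Lemma norm_rV_le (u : 'rV[R]_n.+1) (a : R) : (forall i, `|u ord0 i| <= a) -> `|u| <= a.
Proof.
move=> ua; rewrite [leLHS]/Num.norm /= mx_normrE; apply/bigmax_leP; split => [|[j i] _ /=].
  by apply: le_trans (ua ord0).
by rewrite (ord1 j).
Qed.

(* If the gradient vanished at [p], then [f x] would be [O(|x - p|^2)]; but the point
   [x = g (h p + e *: basis vector)] has [f x - f p = e] and [|x - p| = O(e)]. *)
Lemma diffeomorphism_grad_neq0 (U W : set 'rV[R]_n.+1) h p :
  diffeomorphism U W h -> U p -> grad (fun x => h x ord0 ord_max) p != 0.
Proof.
move=> [oU oW hUW smh [g gK smg]] Up; set f := fun x => _.
have Wc : W (h p) by rewrite -hUW; exists p.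
have [C C0 fC] := class_C2_taylor oU Up (smh 2 ord_max).
have /choice[L LP] : forall i : 'I_n.+1, exists L, 0 <= L /\ \forall r \near (0 : R)^'+, forall x y,
    ball (h p) r x -> ball (h p) r y -> `|g y ord0 i - g x ord0 i| <= L * `|y - x|.
  by move=> i; have [L L0 LP] := class_C1_lipschitz oW Wc (smg 1 i); exists L.
pose L1 := \sum_i L i.
have L10 : 0 <= L1 by apply: sumr_ge0 => i _; exact: (LP i).1.
apply/eqP => grad0.
have : \forall r \near (0 : R)^'+, 0 < r /\ forall x y,
    ball p r x -> ball p r y -> `|f y - f x - dot (grad f x) (y - x)| <= C * `|y - x| ^+ 2.
  by apply: filterI => //; exact: nbhs_right_gt.
move=> /filter_ex[r2 [r20 fC2]].
have nbL : \forall r \near (0 : R)^'+, forall i x y,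
    ball (h p) r x -> ball (h p) r y -> `|g y ord0 i - g x ord0 i| <= L i * `|y - x|.
  by apply: filter_forall => i; exact: (LP i).2.
have : \forall r \near (0 : R)^'+, 0 < r /\ (ball (h p) r `<=` W /\ forall i x y,
    ball (h p) r x -> ball (h p) r y -> `|g y ord0 i - g x ord0 i| <= L i * `|y - x|).
  apply: filterI; first exact: nbhs_right_gt.
  apply: filterI; first by apply: near_ball_sub; exact: open_nbhs_nbhs.
  exact: nbL.
move=> /filter_ex[r1 [r10 [r1W gL]]].
(* The bound [r1] keeps [y] where [g] is Lipschitz, the next puts [x] in the Taylor ball because
   [|x - p| <= L1 * e], and the last gives [C * (L1 * e)^2 < e]. *)
have : \forall e \near (0 : R)^'+, [/\ 0 < e, e < r1, e < r2 / (L1 + 1) & e < (C * L1 ^+ 2 + 1)^-1].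
  near=> e; split; near: e; [exact: nbhs_right_gt|exact: nbhs_right_lt|
    apply: nbhs_right_lt|apply: nbhs_right_lt].
    by rewrite divr_gt0//; lra.
  by rewrite invr_gt0 ltr_wpDl// mulr_ge0// sqr_ge0.
move=> /filter_ex[e [e0 er1 er2 eC]].
pose y := h p + e *: delta_mx ord0 ord_max.
have yc : `|y - h p| <= e.
  rewrite /y addrAC subrr add0r; apply: norm_rV_le => i; rewrite !mxE eqxx/=.
  case: eqVneq => _; first by rewrite mulr1 gtr0_norm.
  by rewrite mulr0 normr0 ltW.
have by_ : ball (h p) r1 y by rewrite mx_norm_ball /ball_/= distrC; exact: le_lt_trans er1.
have bc : ball (h p) r1 (h p) by exact: ballxx.
have [x Ux hx] : exists2 x, U x & h x = y by have := r1W _ by_; rewrite -hUW => -[x]; exists x.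
have xp : `|x - p| <= L1 * e.
  apply: norm_rV_le => i; rewrite !mxE -{1}(gK x Ux) -{1}(gK p Up) hx.
  apply: le_trans (gL i _ _ bc by_) _; rewrite ler_pM ?(LP i).1//.
  by rewrite /L1 (bigD1 i)//= lerDl; apply: sumr_ge0 => j _; exact: (LP j).1.
have bx : ball p r2 x.
  rewrite mx_norm_ball /ball_/= distrC; apply: le_lt_trans xp _.
  by move: er2; rewrite ltr_pdivlMr; nra.
have := fC2 p x (ballxx _ r20) bx.
have -> : f x - f p = e.
  by rewrite /f hx /y !mxE !eqxx mulr1 addrAC subrr add0r.
rewrite grad0 dot0l subr0 gtr0_norm//.
rewrite leNgt => /negP; apply.
apply: (@le_lt_trans _ _ (C * (L1 * e) ^+ 2)).
  by rewrite ler_wpM2l// ler_pXn2r ?nnegrE// mulr_ge0// ltW.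
have D0 : 0 < C * L1 ^+ 2 + 1 by rewrite ltr_wpDl// mulr_ge0// sqr_ge0.
move: eC; rewrite -div1r ltr_pdivlMr// => eC.
have -> : C * (L1 * e) ^+ 2 = (C * L1 ^+ 2 * e) * e by ring.
by rewrite -[ltRHS]mul1r ltr_pM2r//; lra.
Unshelve. all: by end_near. Qed.

(** A reach condition on both sides of the tangent hyperplane at once: a chart does not tell which
    side is that of [V]. *)
Definition two_balls (M : set 'rV[R]_n.+1) q (r : R) := exists2 nu : 'rV[R]_n.+1,
  enorm nu = 1 & forall x, M x -> r <= enorm (x - (q + r *: nu)) /\ r <= enorm (x - (q - r *: nu)).

Lemma sphere_dot x q nu (r : R) : enorm nu = 1 -> 0 < r -> enorm (x - (q + r *: nu)) < r ->
  enorm (x - q) ^+ 2 < 2 * r * dot nu (x - q).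
Proof.
move=> nu1 r0; rewrite -(@ltr_pXn2r _ 2)// ?nnegrE ?enorm_ge0 ?(ltW r0)//.
rewrite opprD addrA !sqr_enorm dot_sqrBZ -(sqr_enorm nu) nu1; lra.
Qed.

(** The last coordinate [f] of the chart vanishes on [M], so by Taylor [dot (grad f q) (x - q)] is
    [O(|x - q|^2)] for [x], [q] in [M]. Inside a touching ball [|x - q|^2 < 2 * r * dot nu (x - q)],
    which for small [r] is incompatible with a gradient bounded away from [0]. *)
Lemma local_two_balls (M : set 'rV[R]_n.+1) p : smooth_hypersurface M -> M p ->
  \forall q \near p & r \near (0 : R)^'+, M q -> two_balls M q r.
Proof.
move=> smM Mp; have [U [W [h [Up dh hM]]]] := smM p Mp.
have /eqP/rowP := diffeomorphism_grad_neq0 dh Up.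
set f := fun x => h x ord0 ord_max => /existsNP[k]; rewrite !mxE => /eqP Dk0.
have [oU oW hUW smh _] := dh.
have fM x : U x -> M x -> f x = 0.
  move=> Ux Mx; have : (h @` (U `&` M)) (h x) by exists x.
  by rewrite hM => -[].
have [C C0 fC] := class_C2_taylor oU Up (smh 2 ord_max).
pose m := `|'D_(delta_mx ord0 k) f p|.
have m0 : 0 < m by rewrite normr_gt0.
have [_ Cf] := smh 1 ord_max; have [_ [/(_ _ Up) cD _]] := Cf k.
have : \forall r \near (0 : R)^'+, [/\ 0 < r, ball p r `<=` U,
    ball p r `<=` [set z | m / 2 <= enorm (grad f z)] &
    forall x y, ball p r x -> ball p r y ->
      `|f y - f x - dot (grad f x) (y - x)| <= C * `|y - x| ^+ 2].
  near=> r; split; near: r; [exact: nbhs_right_gt| | |exact: fC].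
    by apply: near_ball_sub; exact: open_nbhs_nbhs.
  apply: near_ball_sub.
  have m20 : 0 < m / 2 by rewrite divr_gt0.
  have /(@cvgrPdist_lt _ _ _ _ (nbhs_filter p))/(_ _ m20) := cD.
  apply: filterS => z /= pz; apply: le_trans (normr_le_enorm_coord _ k).
  rewrite mxE.
  have := ler_normD ('D_(delta_mx ord0 k) f p - 'D_(delta_mx ord0 k) f z)
    ('D_(delta_mx ord0 k) f z).
  rewrite subrK; move: pz; rewrite /m -/f; lra.
move=> /filter_ex[r0 [r00 r0U r0m fC0]].
near=> q r => Mq.
have bq : `|p - q| < r0 / 2.
  near: q; apply/nbhs_ballP; exists (r0 / 2) => /=; first by rewrite divr_gt0.
  by move=> z; rewrite mx_norm_ball.
have rpos : 0 < r by near: r; exact: nbhs_right_gt.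
(* A point inside a touching ball is within [2 * r] of [q], hence in the ball of radius [r0] about
   [p]. The next bound on [r] excludes the outcome [m / 2 <= 2 * C * r] of the comparison; its [+ 1]
   covers [C = 0]. *)
have r4 : r < r0 / 4 by near: r; apply: nbhs_right_lt; rewrite divr_gt0.
have rC : r < m / (4 * C + 1) by near: r; apply: nbhs_right_lt; rewrite divr_gt0//; lra.
have bqr0 : ball p r0 q by rewrite mx_norm_ball /ball_/=; lra.
pose G := enorm (grad f q).
have Gm : m / 2 <= G by exact: r0m.
have G0 : 0 < G by lra.
pose nu := G^-1 *: grad f q.
have nu1 : enorm nu = 1 by rewrite enormZ gtr0_norm ?invr_gt0// mulVf// gt_eqF.
have key w : enorm w = 1 -> (forall v, `|dot (grad f q) v| = G * `|dot w v|) ->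
    forall x, M x -> r <= enorm (x - (q + r *: w)).
  move=> w1 wG x Mx; rewrite leNgt; apply/negP => xr.
  have xq2 : enorm (x - q) < 2 * r.
    have := enormD (x - (q + r *: w)) (r *: w).
    have -> : x - (q + r *: w) + r *: w = x - q by rewrite opprD addrA subrK.
    by rewrite enormZ w1 mulr1 gtr0_norm//; lra.
  have bx : ball p r0 x.
    rewrite mx_norm_ball /ball_/=; have := ler_distD q p x; have := ler_norm_enorm (x - q).
    rewrite (distrC x); lra.
  have := fC0 q x bqr0 bx.
  rewrite (fM x) ?(fM q)//; [|exact: r0U|exact: r0U].
  rewrite subrr sub0r normrN wG.
  have s := sphere_dot w1 rpos xr.
  have nx : C * `|x - q| ^+ 2 <= C * enorm (x - q) ^+ 2.
    by rewrite ler_wpM2l// ler_pXn2r ?nnegrE ?enorm_ge0// ler_norm_enorm.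
  have d0 : 0 < dot w (x - q).
    by have := le_lt_trans (sqr_ge0 _) s; rewrite pmulr_rgt0// mulr_gt0.
  rewrite gtr0_norm// => /le_trans/(_ nx).
  move: rC; rewrite ltr_pdivlMr; last lra.
  move=> rC hG.
  have h1 : C * enorm (x - q) ^+ 2 <= C * (2 * r * dot w (x - q)) by rewrite ler_wpM2l// ltW.
  have h2 : m / 2 * dot w (x - q) <= G * dot w (x - q) by rewrite ler_wpM2r// ltW.
  have h3 : m / 2 * dot w (x - q) <= 2 * C * r * dot w (x - q) by lra.
  by move: h3; rewrite ler_pM2r//; nra.
exists nu => // x Mx.
have nuG v : `|dot (grad f q) v| = G * `|dot nu v|.
  by rewrite /nu dotZl normrM gtr0_norm ?invr_gt0// mulrA divff ?mul1r// gt_eqF.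
split; first by exact: key.
rewrite -scalerN; apply: key => //; first by rewrite enormN.
by move=> v; rewrite dotNl normrN.
Unshelve. all: by end_near. Qed.

(** In [local_two_balls] the point and the radius vary together, which is the form in which
    compactness yields one radius for all points. *)
Lemma uniform_two_balls (M : set 'rV[R]_n.+1) : smooth_hypersurface M -> compact M ->
  exists2 r, 0 < r & forall q, M q -> two_balls M q r.
Proof.
move=> smM /compact_near_coveringP cM.
have FF : Filter (0 : R)^'+ by exact: within_filter.
have P := cM _ _ (fun r q => M q -> two_balls M q r) FF (fun p => local_two_balls smM (p := p)).
have : \forall r \near (0 : R)^'+, 0 < r /\ M `<=` (fun q => M q -> two_balls M q r).
  by apply: filterI; [exact: nbhs_right_gt|exact: P].
by move=> /filter_ex[r [r0 Mr]]; exists r => // q Mq; exact: Mr.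
Qed.

End smooth.

(** * Gluing polynomials *)

Section polynomials.
Context (R : realType).
Implicit Types p q f s : {poly R}.

Lemma poly_le_limit (c : R) p : (\forall e \near (0 : R)^'+, c <= p.[e]) -> c <= p.[0].
Proof.
move=> cp; have p0 : p.[e] @[e --> (0 : R)^'+] --> p.[0].
  by apply: cvg_at_right_filter; exact: continuous_horner.
by rewrite -(cvg_lim _ p0)//; apply: limr_ge => //; apply/cvg_ex; exists p.[0].
Qed.

Lemma poly_nonneg_lead (c : R) p : (forall x, c <= x -> 0 <= p.[x]) -> p != 0 ->
  0 < lead_coef p.
Proof.
move=> p0; rewrite -lead_coef_eq0 => lp0.
rewrite lt_neqAle eq_sym lp0 /= leNgt; apply/negP => lp.
have [x xP _] : exists2 x, forall y, y >= x -> lead_coef (- p) <= (- p).[y] & True.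
  have lp' : 0 < lead_coef (- p) by rewrite lead_coefN oppr_gt0.
  have [x xP] := polyrcf.poly_pinfty_gt_lc lp'; by exists x.
have := xP (Num.max c x); rewrite le_max lexx orbT => /(_ isT).
have := p0 (Num.max c x); rewrite le_max lexx => /(_ isT).
rewrite hornerN lead_coefN; lra.
Qed.

(** Were [p] of larger degree, the leading coefficients of [p] and [q - p] would be opposite, while
    both are positive. *)
Lemma size_poly_between (c : R) p q : (forall x, c <= x -> 0 <= p.[x] <= q.[x]) ->
  (size p <= size q)%N.
Proof.
move=> pq; rewrite leqNgt; apply/negP => sqp.
have sqp' : (size q < size (- p))%N by rewrite size_polyN.
have : 0 < lead_coef p.
  apply: (poly_nonneg_lead (c := c)) => [x /pq/andP[] //|].
  by rewrite -size_poly_gt0 (leq_ltn_trans _ sqp).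
have : 0 < lead_coef (- p + q).
  apply: (poly_nonneg_lead (c := c)) => [x /pq/andP[_]|].
    by rewrite hornerD hornerN addrC subr_ge0.
  by rewrite -size_poly_gt0 size_polyDl// (leq_ltn_trans _ sqp').
by rewrite lead_coefDl// lead_coefN; lra.
Qed.

(** The coefficients do not depend on [q]: errors at the nodes are multiplied by fixed constants,
    whichever approximating polynomial is used. *)
Lemma poly_extrapolation (N : nat) (x : R) (y : nat -> R) : (0 < N)%N -> injective y ->
  exists c : 'I_N -> R, forall q, (size q <= N)%N -> q.[x] = \sum_j c j * q.[y j].
Proof.
move=> N0 yinj; exists (fun j => (tnth (lagrange N y) j : {poly R}).[x]) => q qN.
rewrite [in LHS](lagrange_gen N0 yinj qN) horner_sum.
by apply: eq_bigr => j _; rewrite hornerM hornerC mulrC.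
Qed.

(* The values of [f] at the points [r + j] determine the one at [r - t], by Lagrange
   interpolation; the error made in replacing [f] by [s] or [p] is at most [H.[e]], where
   [H] is a polynomial vanishing at [0]. *)
Lemma poly_glue (s p : {poly R}) (r t1 : R) (v : R -> R) : 0 < t1 -> t1 <= r ->
  (forall u, 0 <= u -> 0 <= v u) ->
  (forall u, 0 <= u -> v (r + u) = s.[u]) ->
  (forall t, 0 < t -> t < t1 -> v (r - t) = p.[t]) ->
  (forall e, 0 < e -> exists f : {poly R}, forall u, 0 <= u -> v u <= f.[u] <= v ((1 + e) * u)) ->
  forall t, 0 < t -> t < t1 -> p.[t] = s.[- t].
Proof.
move=> t10 t1r v0 vs vp vf t t0 tt1.
(* The successor keeps [N] positive when [s = 0]. *)
pose N := (size s).+1.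
pose y (j : nat) : R := r + j%:R.
have yinj : injective y by move=> i j /addrI /eqP; rewrite eqr_nat => /eqP.
have [c cP] := @poly_extrapolation N (r - t) y isT yinj.
(* The arguments come from [(1 + e) * (r - t) = r - (t - (r - t) * e)] and
   [(1 + e) * y j = r + (j + y j * e)], at which [v] is given by [p] and [s]. *)
pose H : {poly R} := p \Po (t%:P - (r - t) *: 'X) - p.[t]%:P +
  \sum_(j < N) `|c j| *: (s \Po ((j : nat)%:R%:P + y j *: 'X) - s.[(j : nat)%:R]%:P).
have HE e : H.[e] = p.[t - (r - t) * e] - p.[t] +
    \sum_(j < N) `|c j| * (s.[(j : nat)%:R + y j * e] - s.[(j : nat)%:R]).
  rewrite /H hornerD horner_sum; congr (_ + _).
    by rewrite !(hornerD, hornerN, hornerC, horner_comp, hornerZ, hornerX).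
  by apply: eq_bigr => j _; rewrite !(hornerZ, hornerD, hornerN, hornerC, horner_comp, hornerX).
have H0 : H.[0] = 0.
  rewrite HE mulr0 subr0 subrr add0r big1// => j _.
  by rewrite mulr0 addr0 subrr mulr0.
apply/eqP; rewrite -subr_eq0 -normr_le0.
have := @poly_le_limit `|p.[t] - s.[- t]| H; rewrite H0; apply.
have rt0 : 0 < r - t by lra.
near=> e.
have e0 : 0 < e by near: e; exact: nbhs_right_gt.
have et : e < t / (r - t) by near: e; apply: nbhs_right_lt; rewrite divr_gt0.
have {}et : (r - t) * e < t by move: et; rewrite ltr_pdivlMr// mulrC.
have re0 : 0 < (r - t) * e by rewrite mulr_gt0.
have [f fP] := vf e e0.
have sf : (size f <= N)%N.
  pose q : {poly R} := s \Po ((1 + e) *: 'X - r%:P).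
  have sq : size q = size s.
    have e1 : 1 + e != 0 by rewrite gt_eqF//; lra.
    have sX : size ((1 + e) *: 'X : {poly R}) = 2 by rewrite size_scale// size_polyX.
    apply: size_comp_poly2; rewrite size_polyDl sX// size_polyN.
    by rewrite ltnS size_polyC_leq1.
  rewrite /N -sq leqW//; apply: (@size_poly_between r) => u ru.
  have u0 : 0 <= u by lra.
  have /andP[f1 f2] := fP u u0; apply/andP; split; first exact: le_trans (v0 _ u0) f1.
  apply: le_trans f2 _; rewrite horner_comp !(hornerZ, hornerD, hornerN, hornerC, hornerX).
  rewrite -vs; first by rewrite [r + _]addrC subrK.
  have : 0 <= e * u by rewrite mulr_ge0// ltW.
  lra.
pose q0 : {poly R} := s \Po ('X - r%:P).
have q0E u : q0.[u] = s.[u - r] by rewrite horner_comp !hornerE.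
have sq0 : (size q0 <= N)%N by rewrite size_comp_poly2 ?size_XsubC.
have fx := cP f sf; have q0x := cP q0 sq0.
have -> : s.[- t] = q0.[r - t] by rewrite q0E; congr (s.[_]); ring.
have -> : p.[t] - q0.[r - t] = (p.[t] - f.[r - t]) + (f.[r - t] - q0.[r - t]) by ring.
rewrite HE; apply: le_trans (ler_normD _ _) _; apply: lerD.
  have /andP[] := fP (r - t) (ltW rt0).
  rewrite vp// => f1 f2.
  rewrite distrC ger0_norm ?subr_ge0// lerB//; apply: le_trans f2 _.
  rewrite -vp; [|lra|lra].
  by have -> : (1 + e) * (r - t) = r - (t - (r - t) * e) by ring.
rewrite fx q0x -sumrB; apply: le_trans (ler_norm_sum _ _ _) _.
apply: ler_sum => j _; rewrite -mulrBr normrM ler_wpM2l//.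
have j0 : (0 : R) <= (j : nat)%:R by rewrite ler0n.
have y0 : 0 <= y j by rewrite /y; lra.
have /andP[] := fP (y j) y0.
have -> : v (y j) = q0.[y j] by rewrite q0E /y addrAC subrr add0r vs.
move=> f1 f2; rewrite ger0_norm ?subr_ge0//.
have -> : q0.[y j] = s.[(j : nat)%:R] by rewrite q0E /y addrAC subrr add0r.
rewrite lerB//; apply: le_trans f2 _.
rewrite -vs; last by rewrite addr_ge0// mulr_ge0// ltW.
by have -> : (1 + e) * y j = r + ((j : nat)%:R + y j * e) by rewrite /y; ring.
Unshelve. all: by end_near. Qed.

Lemma poly_eq_near0 p q (t1 : R) : 0 < t1 -> (forall t, 0 < t -> t < t1 -> p.[t] = q.[t]) -> p = q.
Proof.
move=> t10 pq; apply/eqP; rewrite -subr_eq0; apply/eqP; apply: contrapT => /eqP d0.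
pose N := size (p - q).
(* Dividing by at least [2] keeps these roots strictly below [t1]. *)
pose xs := [seq t1 / (i.+2)%:R | i <- iota 0 N].
have : (size xs < N)%N.
  apply: max_poly_roots => //.
    apply/allP => _ /mapP[i _ ->]; apply/rootP; rewrite hornerD hornerN pq ?subrr//.
      by rewrite divr_gt0.
    by rewrite ltr_pdivrMr// ltr_pMr// ltr1n.
  rewrite map_inj_uniq ?iota_uniq// => i j /mulfI h.
  have /invr_inj/eqP : (i.+2)%:R^-1 = (j.+2)%:R^-1 :> R by apply: h; rewrite gt_eqF.
  by rewrite eqr_nat => /eqP [].
by rewrite size_map size_iota ltnn.
Qed.

End polynomials.

(** * Boundary of a convex body *)

Section convex.
Context (R : realType) (n : nat).
Implicit Types (V K A : set 'rV[R]_n.+1) (x y z q nu : 'rV[R]_n.+1).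

Lemma boundaryE V : closed V -> boundary V = V `\` interior V.
Proof. by move=> cV; rewrite /boundary -(closure_id V).1. Qed.

Lemma closed_boundary V : closed V -> closed (boundary V).
Proof.
move=> cV; rewrite boundaryE// setDE; apply: closedI => //.
by apply: open_closedC; exact: open_interior.
Qed.

Lemma closed_compact_rV V : compact V -> closed V.
Proof. by move=> cV; apply: compact_closed cV; exact: norm_hausdorff. Qed.

Lemma compact_boundary V : compact V -> compact (boundary V).
Proof.
move=> cV; have clV := closed_compact_rV cV.
by apply: (subclosed_compact (closed_boundary clV) cV); rewrite boundaryE// => x [].
Qed.

(** The boundary point is the last point of the segment in [V]: from an interior point one could go
    further. *)
Lemma segment_boundary V x y : closed V -> V x -> ~ V y ->
  exists2 l, 0 <= l <= 1 & boundary V (x + l *: (y - x)).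
Proof.
move=> clV Vx nVy; pose S := [set l : R | V (x + l *: (y - x))] `&` `[0, 1]%classic.
have cvl : continuous (fun l : R => x + l *: (y - x)).
  move=> l; apply: cvgD; first exact: cvg_cst.
  exact: scalel_continuous.
have clS : closed [set l : R | V (x + l *: (y - x))].
  by apply: (@closed_comp _ _ (fun l : R => x + l *: (y - x)) V) => // l _; exact: cvl.
have cS : compact S by rewrite /S setIC; apply: compact_closedI => //; exact: segment_compact.
have S0 : S !=set0 by exists 0; split; rewrite /= ?scale0r ?addr0// in_itv/= lexx ler01.
have [|l lS lmax] := @compact_EVT_max _ R id S S0 cS.
  by apply: continuous_subspaceT => u; exact: cvg_id.
rewrite inE in lS; case: lS => /= Vl; rewrite in_itv/= => /andP[l0 l1].
exists l; first by rewrite l0.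
rewrite boundaryE//; split => // intl.
have l_lt1 : l < 1.
  rewrite lt_neqAle l1 andbT; apply/eqP => l1'; apply: nVy.
  by move: Vl; rewrite l1' scale1r addrC subrK.
have : \forall e \near (0 : R)^'+, V (x + (l + e) *: (y - x)).
  have h : \forall u \near l, V (x + u *: (y - x)) by apply: cvl; exact: intl.
  have {}h : \forall e \near (0 : R), V (x + (l + e) *: (y - x)).
    have ce : (fun e : R => l + e) @ (0 : R) --> l.
      by rewrite -[X in _ --> X]addr0; apply: cvgD; [exact: cvg_cst|exact: cvg_id].
    exact: (ce _ h).
  exact: cvg_within.
move=> ne.
have : \forall e \near (0 : R)^'+, [/\ 0 < e, e < 1 - l & V (x + (l + e) *: (y - x))].
  near=> e; split; [| |near: e; exact: ne]; near: e; [exact: nbhs_right_gt|].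
  by apply: nbhs_right_lt; rewrite subr_gt0.
move=> /filter_ex[e [e0 el Ve]].
have /lmax : (l + e) \in S.
  by rewrite inE; split => //=; rewrite in_itv/=; apply/andP; split; lra.
by rewrite /=; lra.
Unshelve. all: by end_near. Qed.

(** The homothety of centre [y] and ratio [l] carries a ball about [x] inside [V] to a ball inside
    [V]. *)
Lemma interior_convex V x y (l : R) : is_convex V -> interior V x -> V y -> 0 < l -> l <= 1 ->
  interior V (l *: x + (1 - l) *: y).
Proof.
move=> cV /nbhs_enormP[e e0 eV] Vy l0 l1; apply/nbhs_enormP.
exists (l * e); first by rewrite mulr_gt0.
move=> z; set c := l *: x + _ => cz.
have -> : z = l *: (x + l^-1 *: (z - c)) + (1 - l) *: y.
  by apply/rowP => i; rewrite /c !mxE; field; rewrite gt_eqF.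
apply: cV => //; [apply: eV|exact: ltW].
by rewrite opprD addrA subrr sub0r enormN enormZ gtr0_norm ?invr_gt0// ltr_pdivrMl// enormB.
Qed.

(** At a boundary point [q] the vector [nu] is the inward unit normal: a rolling-ball condition
    together with the supporting half-space. *)
Definition inner_ball V q (r : R) nu :=
  [/\ enorm nu = 1, (forall x, enorm (x - (q + r *: nu)) <= r -> V x) &
      forall z, V z -> 0 <= dot (z - q) nu].

(** A segment joining a point of [V] to a point outside it crosses the boundary, and an open ball
    contains the segment between any two of its points. *)
Lemma ball_separation V c (r : R) : closed V ->
  (forall x, boundary V x -> r <= enorm (x - c)) ->
  (forall x, enorm (x - c) < r -> V x) \/ (forall x, enorm (x - c) < r -> ~ V x).
Proof.
move=> clV Bc; have [[x [xc Vx]]|nx] := pselect (exists x, enorm (x - c) < r /\ V x); last first.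
  by right => x xc Vx; apply: nx; exists x.
left => y yc; apply: contrapT => nVy.
have [l /andP[l0 l1] /Bc] := segment_boundary clV Vx nVy.
apply/negP; rewrite -ltNge.
have -> : x + l *: (y - x) - c = (1 - l) *: (x - c) + l *: (y - c).
  by apply/rowP => i; rewrite !mxE; ring.
apply: le_lt_trans (enormD _ _) _; rewrite !enormZ !ger0_norm ?subr_ge0//.
have r0 : 0 < r by apply: le_lt_trans (enorm_ge0 _) xc.
have [->|ln0] := eqVneq l 0; first by rewrite subr0 mul1r mul0r addr0.
have lp : 0 < l by rewrite lt_neqAle eq_sym ln0.
have : l * enorm (y - c) < l * r by rewrite ltr_pM2l.
have : (1 - l) * enorm (x - c) <= (1 - l) * r by rewrite ler_wpM2l ?subr_ge0// ltW.
lra.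
Qed.

Lemma ball_disjoint_dot V q nu (r : R) : is_convex V -> V q -> enorm nu = 1 -> 0 < r ->
  (forall x, enorm (x - (q + r *: nu)) < r -> ~ V x) -> forall z, V z -> dot (z - q) nu <= 0.
Proof.
move=> cV Vq nu1 r0 nV z Vz; set p := dot _ _; rewrite leNgt; apply/negP => p0.
pose m := dot (z - q) (z - q).
have m0 : 0 <= m by exact: dot_ge0.
(* The squared distance from [q + l *: (z - q)] to the centre is [r^2 - 2 * l * r * p + l^2 * m],
   below [r^2] as soon as [l * m < 2 * r * p]. *)
pose l := Num.min 1 (r * p / (m + 1)).
have l0 : 0 < l by rewrite lt_min ltr01/= divr_gt0 ?mulr_gt0//; lra.
have l1 : l <= 1 by rewrite ge_min lexx.
have lm : l * (m + 1) <= r * p by rewrite -ler_pdivlMr ?ge_min ?lexx ?orbT//; lra.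
apply: (nV (l *: z + (1 - l) *: q)); last by apply: cV => //; exact: ltW.
rewrite -(@ltr_pXn2r _ 2)// ?nnegrE ?enorm_ge0 ?(ltW r0)// sqr_enorm.
have -> : l *: z + (1 - l) *: q - (q + r *: nu) = l *: (z - q) - r *: nu.
  by apply/rowP => i; rewrite !mxE; ring.
rewrite dot_sqrBZ !dotZl !dotZr -(sqr_enorm nu) nu1 (dotC nu) -/p -/m.
have : l * (l * m) <= l * (r * p - l) by rewrite ler_pM2l//; lra.
have : 0 < l * l by rewrite mulr_gt0.
have : 0 < l * (r * p) by rewrite !mulr_gt0.
lra.
Qed.

Lemma closed_ball_sub V c (r : R) : closed V -> 0 < r ->
  (forall x, enorm (x - c) < r -> V x) -> forall x, enorm (x - c) <= r -> V x.
Proof.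
move=> clV r0 bV x xc; apply: contrapT => nVx.
have oV : open (~` V) by exact: closed_openC.
have [e e0 eV] := (open_enormP (~` V)).1 oV x nVx.
(* Pulling [x] towards the centre by the ratio [l] moves it by at most [l * r <= e / 2], so it stays
   off [V] yet enters the open ball. *)
pose l := Num.min 1 (e / (2 * r)).
have l0 : 0 < l by rewrite lt_min ltr01/= divr_gt0// mulr_gt0.
have l1 : l <= 1 by rewrite ge_min lexx.
have le : l * (2 * r) <= e by rewrite -ler_pdivlMr ?ge_min ?lexx ?orbT// mulr_gt0.
apply: (eV (x - l *: (x - c))).
  rewrite opprB addrC subrK enormZ gtr0_norm//.
  have : l * enorm (x - c) <= l * r by rewrite ler_pM2l.
  have : 0 < l * r by rewrite mulr_gt0.
  lra.
apply: bV.
have -> : x - l *: (x - c) - c = (1 - l) *: (x - c) by apply/rowP => i; rewrite !mxE; ring.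
rewrite enormZ ger0_norm ?subr_ge0//.
have : (1 - l) * enorm (x - c) <= (1 - l) * r by rewrite ler_wpM2l ?subr_ge0.
have : 0 < l * r by rewrite mulr_gt0.
lra.
Qed.

(* Of the two balls touching the boundary at [q], both cannot miss [V], as [V] has interior
   points off the tangent hyperplane, nor both lie in [V], as [q] would be interior. *)
Lemma exists_inner_ball V q (r : R) : closed V -> is_convex V -> interior V !=set0 -> 0 < r ->
  boundary V q -> two_balls (boundary V) q r -> exists nu, inner_ball V q r nu.
Proof.
move=> clV cV [z0 intz0] r0 Bq [nu nu1 Bnu].
have [Vq nintq] : V q /\ ~ interior V q by move: Bq; rewrite boundaryE// => -[].
have [e e0 eV] : exists2 e, 0 < e & forall y, enorm (z0 - y) < e -> V y by exact/nbhs_enormP.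
have Vz0 : V z0 by apply: interior_subset.
have case_in mu : enorm mu = 1 -> (forall x, enorm (x - (q + r *: mu)) < r -> V x) ->
    (forall x, enorm (x - (q - r *: mu)) < r -> ~ V x) -> inner_ball V q r mu.
  move=> mu1 inV outV; split => //; first exact: closed_ball_sub.
  move=> z Vz; have := @ball_disjoint_dot V q (- mu) r cV Vq _ r0 _ z Vz.
  rewrite enormN scalerN dotNr => /(_ mu1 outV); lra.
have [in1|out1] := ball_separation clV (fun x Bx => (Bnu x Bx).1);
have [in2|out2] := ball_separation clV (fun x Bx => (Bnu x Bx).2).
- exfalso; apply: nintq.
  have -> : q = (1 / 2) *: (q + r *: nu) + (1 - 1 / 2) *: (q - r *: nu).
    by apply/rowP => i; rewrite !mxE; field.
  apply: interior_convex => //; [|by apply: in2; rewrite subrr enorm0|lra].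
  by apply/nbhs_enormP; exists r => // y yc; apply: in1; rewrite enormB.
- by exists nu; exact: case_in.
- by exists (- nu); apply: case_in; rewrite ?enormN// scalerN ?opprK.
- exfalso.
  have d1 := ball_disjoint_dot cV Vq nu1 r0 out1.
  have d2 z : V z -> 0 <= dot (z - q) nu.
    move=> Vz; have := @ball_disjoint_dot V q (- nu) r cV Vq _ r0 _ z Vz.
    rewrite enormN scalerN dotNr => /(_ nu1 out2); lra.
  have Vz : V (z0 + (e / 2) *: nu).
    by apply: eV; rewrite opprD addrA subrr sub0r enormN enormZ nu1 mulr1 gtr0_norm; lra.
  have := d1 _ Vz; have := d2 _ Vz0.
  by rewrite addrAC (dotDl (z0 - q)) dotZl -sqr_enorm nu1; lra.
Qed.

End convex.

(** * Parallel bodies and tubes *)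

Section parallel.
Context (R : realType) (n : nat).
Variables (V : set 'rV[R]_n.+1) (V_compact : compact V) (V_convex : is_convex V)
  (V_interior : interior V !=set0).
Let M := boundary V.
Let V_closed : closed V := closed_compact_rV V_compact.

Lemma boundary_sub x : M x -> V x.
Proof. by rewrite /M boundaryE// => -[]. Qed.

Lemma boundary_nonempty : M !=set0.
Proof.
have [v /interior_subset Vv] := V_interior.
have [B [_ /(_ (B + 1))VB]] := compact_bounded V_compact.
have {}VB u : V u -> `|u| <= B + 1 by apply: VB; rewrite ltrDl.
have nV : ~ V (const_mx (B + 2)).
  move=> /VB; have := normr_coord_le (const_mx (B + 2) : 'rV[R]_n.+1) ord0.
  by rewrite mxE => /le_trans h /h; have := ler_norm (B + 2); lra.
by have [l _ Ml] := segment_boundary V_closed Vv nV; exists (v + l *: (const_mx (B + 2) - v)).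
Qed.

(** The Minkowski difference of [V] and the ball of radius [r]. *)
Definition inner_parallel (r : R) : set 'rV[R]_n.+1 :=
  [set x | forall b, enorm b <= r -> V (x + b)].

Lemma inner_parallel_sub r : 0 <= r -> inner_parallel r `<=` V.
Proof. by move=> r0 x /(_ 0); rewrite enorm0 addr0; apply. Qed.

Lemma convex_inner_parallel r : is_convex (inner_parallel r).
Proof.
move=> x y l Kx Ky l0 l1 b br.
have -> : l *: x + (1 - l) *: y + b = l *: (x + b) + (1 - l) *: (y + b).
  by apply/rowP => i; rewrite !mxE; ring.
by apply: V_convex => //; [exact: Kx|exact: Ky].
Qed.

Lemma compact_inner_parallel r : 0 <= r -> compact (inner_parallel r).
Proof.
move=> r0; apply: (subclosed_compact _ V_compact (inner_parallel_sub r0)).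
rewrite -[inner_parallel r]setCK; apply: open_closedC; apply/open_enormP => x.
move=> /existsNP[b /not_implyP[br nV]].
have oV : open (~` V) by exact: closed_openC.
have [e e0 eV] := (open_enormP (~` V)).1 oV _ nV.
exists e => // y xy /(_ b br); apply: eV.
by rewrite opprD addrACA subrr addr0.
Qed.

(** If [x + b] were outside, the segment from [x] would cross the boundary at some [x + l *: b] with
    [delta <= l * enorm b]; this forces [l = 1], and boundary points belong to [V]. *)
Lemma dist_boundary_ball x b (delta : R) : V x -> (forall y, M y -> delta <= enorm (x - y)) ->
  0 < delta -> enorm b <= delta -> V (x + b).
Proof.
move=> Vx xM d0 bd; apply: contrapT => nV.
have [l /andP[l0 l1] Ml] := segment_boundary V_closed Vx nV.
rewrite addrAC subrr add0r in Ml.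
have := xM _ Ml; rewrite opprD addrA subrr sub0r enormN enormZ ger0_norm// => dl.
have l_eq1 : l = 1.
  apply/eqP; rewrite eq_le l1 leNgt; apply/negP => ll.
  have : l * enorm b <= l * delta by rewrite ler_wpM2l.
  have : l * delta < 1 * delta by rewrite ltr_pM2r.
  lra.
by apply: nV; apply: boundary_sub; rewrite -[b]scale1r -l_eq1.
Qed.

(** A point of [V] at distance at least [r] from the boundary is in [inner_parallel r]. A nearer one
    lies on the inward normal at its nearest boundary point, between that point and the centre of
    the inner ball, which is in [inner_parallel r]. *)
Lemma parallel_body r t : 0 < r -> (forall q, M q -> exists nu, inner_ball V q r nu) ->
  0 <= t -> t <= r ->
  [set x | V x /\ forall y, M y -> t <= enorm (x - y)] =
  minkowski_sum (inner_parallel r) (cball (r - t)).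
Proof.
move=> r0 ib t0 tr; apply/seteqP; split => x.
  move=> [Vx xM].
  have [y0 My0 ymin] := nearest_point x (compact_boundary V_compact) boundary_nonempty.
  set delta := enorm (x - y0) in ymin.
  have td : t <= delta by exact: xM.
  have [rd|dr] := leP r delta.
    exists x; last by exists 0; rewrite ?addr0// /cball /= enorm0 subr_ge0.
    move=> b br; apply: (@dist_boundary_ball x b r) => // y /ymin; exact: le_trans.
  have [nu [nu1 bV dV]] := ib _ My0.
  (* The ball of radius [delta] about [x] lies in [V], so [x - delta *: nu] does; the supporting
     half-space then gives [delta <= dot (x - y0) nu]. As [enorm (x - y0) = delta], this is equality
     in Cauchy-Schwarz. *)
  have xE : x = y0 + delta *: nu.
    have Vz : V (x - delta *: nu).
      have [d0|d0] := eqVneq delta 0; first by rewrite d0 scale0r subr0.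
      apply: (@dist_boundary_ball x (- (delta *: nu)) delta) => //.
        by rewrite lt_neqAle eq_sym d0 enorm_ge0.
      by rewrite enormN enormZ nu1 mulr1 ger0_norm ?enorm_ge0.
    have := dV _ Vz; rewrite addrAC dotBl dotZl -sqr_enorm nu1 expr1n mulr1 => h.
    apply/eqP; rewrite -subr_eq0 opprD addrA; apply/eqP/enorm_eq0/eqP.
    rewrite -sqrf_eq0 eq_le sqr_ge0 andbT sqr_enorm dot_sqrBZ -!sqr_enorm nu1 -/delta (dotC nu).
    have d0 : 0 <= delta by exact: enorm_ge0.
    have : 0 <= delta * (dot (x - y0) nu - delta) by rewrite mulr_ge0.
    by rewrite expr1n; lra.
  exists (y0 + r *: nu).
    by move=> b br; apply: bV; rewrite addrAC subrr add0r.
  exists ((delta - r) *: nu); last by rewrite xE -addrA -scalerDl [r + _]addrC subrK.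
  by rewrite /cball/= enormZ nu1 mulr1 ler0_norm; lra.
move=> [k Kk [w wr <-]]; rewrite /cball/= in wr.
have Vx : V (k + w) by apply: Kk; lra.
split=> // y My; rewrite leNgt; apply/negP => yt.
have : ~ interior V y by move: My; rewrite /M boundaryE// => -[].
(* By the triangle inequality through [k + w], the ball of this radius about [y] lies in [k + rB],
   hence in [V]. *)
apply; apply/nbhs_enormP; exists (t - enorm (k + w - y)); first by rewrite subr_gt0.
move=> z yz; have -> : z = k + (z - k) by rewrite addrC subrK.
apply: Kk.
have -> : z - k = - (y - z) + (- (k + w - y) + w) by apply/rowP => i; rewrite !mxE; ring.
apply: le_trans (enormD _ _) _; rewrite enormN.
have := enormD (- (k + w - y)) w; rewrite enormN; lra.
Qed.

Lemma minkowski_sum_cball (a b : R) : 0 <= a -> 0 <= b ->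
  minkowski_sum (cball a) (cball b) = cball (a + b) :> set 'rV[R]_n.+1.
Proof.
move=> a0 b0; apply/seteqP; split => [_ [x xa [y yb <-]]|x].
  by rewrite /cball/= in xa yb *; apply: le_trans (enormD _ _) _; exact: lerD.
rewrite /cball/= => xab.
have [ab0|ab0] := eqVneq (a + b) 0.
  have -> : x = 0 by apply/enorm_eq0/eqP; rewrite eq_le enorm_ge0 andbT -ab0.
  by exists 0; [rewrite /= enorm0|exists 0; rewrite ?addr0//= enorm0].
have ab : 0 < a + b by rewrite lt_neqAle eq_sym ab0 addr_ge0.
have h c : 0 <= c -> enorm ((c / (a + b)) *: x) <= c.
  move=> c0; rewrite enormZ ger0_norm ?divr_ge0 ?(ltW ab)//.
  by rewrite mulrAC ler_pdivrMr// ler_wpM2l.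
exists ((a / (a + b)) *: x); first exact: h.
exists ((b / (a + b)) *: x); first exact: h.
by rewrite -scalerDl -mulrDl divff// scale1r.
Qed.

(** At [t = 0], [parallel_body] says that [V] is the sum of its inner parallel body and the ball of
    radius [r]. *)
Lemma inner_parallel_ball r u : 0 < r -> (forall q, M q -> exists nu, inner_ball V q r nu) ->
  0 <= u -> minkowski_sum (inner_parallel r) (cball (r + u)) = minkowski_sum V (cball u).
Proof.
move=> r0 ib u0; rewrite -minkowski_sum_cball ?(ltW r0)// minkowski_sumA; congr minkowski_sum.
rewrite -[r in cball r]subr0 -parallel_body//; last exact: ltW.
by apply/seteqP; split => [x []//|x Vx]; split => // y _; exact: enorm_ge0.
Qed.

(** The boundary is compact, so the infimum in [edistance] is attained. In this form the tube is
    visibly compact. *)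
Lemma tubeE t : tube M t = minkowski_sum M (cball t).
Proof.
have cM : compact M by exact: compact_boundary.
apply/seteqP; split => x.
  rewrite /tube/= /edistance => xt.
  have [y My ymin] := nearest_point x cM boundary_nonempty.
  exists y => //; exists (x - y); last by rewrite addrC subrK.
  rewrite /cball/=; apply: le_trans xt; apply: lb_le_inf.
    by exists (enorm (x - y)); exists y.
  by move=> _ [z Mz <-]; exact: ymin.
move=> [y My [w wt <-]]; rewrite /tube/= /edistance; apply: le_trans wt.
apply: ge_inf; first by exists 0 => _ [z _ <-]; exact: enorm_ge0.
by exists y => //; rewrite addrAC subrr add0r.
Qed.

Lemma tube_sub t : tube M t `<=` minkowski_sum V (cball t).
Proof. by rewrite tubeE; apply: subset_minkowski_sum => //; exact: boundary_sub. Qed.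

Lemma setD_tube t : 0 <= t -> minkowski_sum V (cball t) `\` tube M t =
  [set x | V x /\ forall y, M y -> t < enorm (x - y)].
Proof.
move=> t0; rewrite tubeE; apply/seteqP; split => x.
  move=> [[v Vv [w wt vwx]] nT].
  have far y : M y -> t < enorm (x - y).
    move=> My; rewrite ltNge; apply/negP => xy; apply: nT.
    by exists y => //; exists (x - y) => //; rewrite addrC subrK.
  split => //; apply: contrapT => nVx.
  (* The segment from [v] to [v + w] leaves [V] at a boundary point at distance
     [(1 - l) * enorm w <= t] from [x]. *)
  have [l /andP[l0 l1] Ml] := segment_boundary V_closed Vv nVx.
  have := far _ Ml; rewrite -vwx.
  have -> : v + w - (v + l *: (v + w - v)) = (1 - l) *: w by apply/rowP => i; rewrite !mxE; ring.
  rewrite enormZ ger0_norm ?subr_ge0//; apply/negP; rewrite -leNgt.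
  apply: le_trans wt; rewrite ler_piMl ?enorm_ge0//; lra.
move=> [Vx far]; split.
  by exists x => //; exists 0; rewrite ?addr0// /cball/= enorm0.
move=> [y My [w wt ywx]]; have := far y My.
by rewrite -ywx addrAC subrr add0r ltNge => /negP.
Qed.

Lemma vol_tube_complement (w s : {poly R}) t : 0 <= t ->
  is_steiner_polynomial V s -> volume (tube M t) = (2 * t * w.[t])%:E ->
  volume [set x | V x /\ forall y, M y -> t < enorm (x - y)] = (s.[t] - 2 * t * w.[t])%:E.
Proof.
move=> t0 sP wP.
have cVt : compact (minkowski_sum V (cball t)).
  by apply: compact_minkowski_sum => //; exact: compact_cball.
have cT : compact (tube M t).
  rewrite tubeE; apply: compact_minkowski_sum; first exact: compact_boundary.
  exact: compact_cball.
have := volumeD (measurable_rV_compact cVt) (measurable_rV_compact cT) (@tube_sub t).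
rewrite wP setD_tube// -dilate_unit_ball// sP//.
case: (volume _) => [x| |] //.
by rewrite -EFinD => -[->]; rewrite addrK.
Qed.

(** Inequalities between support functions become inclusions: [u] times the zonotope lies between
    the balls of radii [u] and [(1 + e) * u]. *)
Lemma vol_zonotope_between (K : set 'rV[R]_n.+1) (e : R) : 0 < e -> compact K -> is_convex K ->
  exists f : {poly R}, forall u, 0 <= u ->
    vol (minkowski_sum K (cball u)) <= f.[u] <= vol (minkowski_sum K (cball ((1 + e) * u))).
Proof.
move=> e0 cK convK; have [l lP] := @zsupp_approx R n.+1 _ e0.
have [f fP] := vol_zonotope_poly l cK convK; exists f => u u0.
have cKb t : compact (minkowski_sum K (cball t)).
  by apply: compact_minkowski_sum => //; exact: compact_cball.
have cKz : compact (minkowski_sum K (zonotope [seq u *: e | e <- l])).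
  by apply: compact_minkowski_sum => //; exact: compact_zonotope.
rewrite -fP//; apply/andP; split; apply: le_vol => //; apply: subset_minkowski_sum => //.
  apply: cball_sub_zonotope => x; rewrite zsupp_scale ger0_norm// ler_wpM2l//.
  by case/andP: (lP x).
apply: zonotope_sub_cball => [|x]; first by rewrite mulr_ge0//; lra.
rewrite zsupp_scale ger0_norm// mulrAC [leRHS]mulrC ler_wpM2l//.
by case/andP: (lP x).
Qed.

End parallel.

Lemma near_right0P (R : realType) (P : R -> Prop) : (\forall t \near (0 : R)^'+, P t) ->
  exists2 e, 0 < e & forall t, 0 < t -> t < e -> P t.
Proof.
move=> /nbhs_ballP[e /= e0 eP]; exists e => // t t0 te; apply: eP => //.
by rewrite /ball/= sub0r normrN gtr0_norm.
Qed.

Unset Implicit Arguments.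

Theorem lemma1p11 (R : realType) (n : nat) (V : set 'rV[R]_n.+1)
    (V_compact : compact V) (V_convex : convex_set V)
    (V_interior : interior V !=set0)
    (bdV_smooth : smooth_hypersurface (boundary V))
    (w s : {poly R}) (w_weyl : is_weyl_polynomial (boundary V) w)
    (s_steiner : is_steiner_polynomial V s) :
  forall t : R, 2 * t * w.[t] = s.[t] - s.[- t].
Proof.
have cV : is_convex V by exact: convex_set_is_convex.
have clV := closed_compact_rV V_compact.
have [r r0 tb] := uniform_two_balls bdV_smooth (compact_boundary V_compact).
have ib q : boundary V q -> exists nu, inner_ball V q r nu.
  by move=> Bq; apply: exists_inner_ball => //; exact: tb.
pose K := inner_parallel V r; pose v u := vol (minkowski_sum K (cball u)).
have cK : compact K by apply: compact_inner_parallel => //; exact: ltW.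
have convK : is_convex K by exact: convex_inner_parallel.
have cKb u : compact (minkowski_sum K (cball u)).
  by apply: compact_minkowski_sum => //; exact: compact_cball.
pose p : {poly R} := s - 2 *: ('X * w).
have pE t : p.[t] = s.[t] - 2 * t * w.[t].
  by rewrite /p hornerD hornerN hornerZ hornerM hornerX mulrA.
clearbody p.
have [e e0 wP] := near_right0P w_weyl.2.
(* The inequality is strict because the tube removed is closed, whereas [K + (r - t)B] is given by
   the weak one. *)
pose I t := [set x | V x /\ forall y, boundary V y -> t < enorm (x - y)].
have mI t : 0 <= t -> measurable_rV (I t).
  move=> t0; rewrite /I -setD_tube//; apply: measurable_rVD; apply: measurable_rV_compact.
    by apply: compact_minkowski_sum => //; exact: compact_cball.
  rewrite tubeE//; apply: compact_minkowski_sum; first exact: compact_boundary.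
  exact: compact_cball.
have IE t : 0 < t -> t < e -> volume (I t) = p.[t]%:E.
  by move=> t0 te; rewrite pE; apply: vol_tube_complement => //; [exact: ltW|exact: wP].
have JE t : 0 <= t -> t <= r ->
    [set x | V x /\ forall y, boundary V y -> t <= enorm (x - y)] = minkowski_sum K (cball (r - t)).
  by move=> t0 tr; exact: parallel_body.
pose t1 := Num.min e r.
have t10 : 0 < t1 by rewrite lt_min e0.
have t1e : t1 <= e by rewrite ge_min lexx.
have t1r : t1 <= r by rewrite ge_min lexx orbT.
have p_le t : 0 < t -> t < t1 -> p.[t] <= v (r - t).
  move=> t0 tt1; rewrite -lee_fin -IE//; last exact: lt_le_trans tt1 t1e.
  rewrite -volE//; apply: le_volume; [by apply: mI; exact: ltW|exact: measurable_rV_compact|].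
  rewrite -JE ?(ltW t0)//; last by apply: ltW; exact: lt_le_trans tt1 t1r.
  by move=> x [Vx far]; split => // y /far/ltW.
have le_p t t' : 0 < t -> t < t' -> t' < t1 -> v (r - t') <= p.[t].
  move=> t0 tt' tt1; rewrite -lee_fin -IE//; last first.
    by apply: lt_trans tt' _; exact: lt_le_trans tt1 t1e.
  rewrite -volE//; apply: le_volume; [exact: measurable_rV_compact|by apply: mI; exact: ltW|].
  rewrite -JE; [|lra|lra].
  by move=> x [Vx far]; split => // y /far; exact: lt_le_trans.
(* The bounds give [v (r - t) <= p.[t - u]] for small [u > 0], and [p] is continuous; so the weak
   and the strict inequality enclose the same volume. *)
have vp t : 0 < t -> t < t1 -> v (r - t) = p.[t].
  move=> t0 tt1; apply: le_anti; rewrite p_le// andbT.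
  have := @poly_le_limit _ (v (r - t)) (p \Po (t%:P - 'X)).
  rewrite horner_comp !hornerE subr0; apply; near=> u.
  have u0 : 0 < u by near: u; exact: nbhs_right_gt.
  have ut : u < t by near: u; exact: nbhs_right_lt.
  by rewrite horner_comp !hornerE; apply: le_p => //; lra.
have vs u : 0 <= u -> v (r + u) = s.[u].
  move=> u0; rewrite /v /K inner_parallel_ball//.
  by rewrite /vol -dilate_unit_ball// s_steiner.
have ps : p = s \Po (- 'X).
  (* Agreement on the interval from [0] to [t1] is enough for an identity of polynomials, valid for
     every real [t]. *)
  apply: (poly_eq_near0 t10) => t t0 tt1; rewrite horner_comp !hornerE.
  apply: (poly_glue (v := v) (r := r) (t1 := t1)) => //.
  - by move=> u u0; exact: vol_ge0.
  - by move=> eps eps0; exact: vol_zonotope_between.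
move=> t; have := congr1 (fun q => q.[t]) ps; rewrite pE horner_comp !hornerE => <-; ring.
Unshelve. all: by end_near. Qed.
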